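(* Let $T_1$ be an unbounded non-negative self-adjoint operator in $\mathcal{H}$ with $\ker T_1=\{0\}$. Then there exist non-negative self-adjoint operators $T_2$ and $T$ in $\mathcal{H}$ such that: (1) $\operatorname{dom}T_1^{1/2}\cap\operatorname{dom}T=\operatorname{dom}T_2^{1/2}\cap\operatorname{dom}T=\{0\}$; (2) for $k=1,2$: $\operatorname{dom}T_k^{1/2}\subset\operatorname{dom}T^{1/2}$ and $\|T_k^{1/2}g\|=\|T^{1/2}g\|$ for all $g\in\operatorname{dom}T_k^{1/2}$; (3) $\operatorname{dom}T_1^{1/2}\cap\operatorname{dom}T_2^{1/2}=\{0\}$; (4) $\operatorname{dom}T^{1/2}=\operatorname{dom}T_1^{1/2}\dotplus\operatorname{dom}T_2^{1/2}$ with $\operatorname{dom}T_1^{1/2}$ and $\operatorname{dom}T_2^{1/2}$ mutually orthogonal with respect to the inner product $(f,g)_{T^{1/2}}:=(T^{1/2}f,T^{1/2}g)+(f,g)$.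
   Context: $\mathcal{H}$ is a complex, infinite-dimensional, separable Hilbert space. $\dotplus$ denotes a direct sum of linear manifolds with trivial intersection. *)

(* Defs.v *)
From Stdlib Require Import Reals.
Open Scope R_scope.
Set Implicit Arguments.

Record C : Type := mkC { Re : R; Im : R }.
Definition C0 : C := mkC 0 0.
Definition C1 : C := mkC 1 0.
Definition Cadd (a b : C) : C := mkC (Re a + Re b) (Im a + Im b).
Definition Cmul (a b : C) : C :=
  mkC (Re a * Re b - Im a * Im b) (Re a * Im b + Im a * Re b).
Definition Cconj (a : C) : C := mkC (Re a) (- Im a).

Record PreHilbert : Type := {
  V :> Type;
  vzero : V;
  vadd : V -> V -> V;
  vopp : V -> V;
  vscal : C -> V -> V;
  inner : V -> V -> C;
  vadd_assoc : forall x y z, vadd x (vadd y z) = vadd (vadd x y) z;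
  vadd_comm : forall x y, vadd x y = vadd y x;
  vadd_0 : forall x, vadd x vzero = x;
  vadd_opp : forall x, vadd x (vopp x) = vzero;
  vscal_1 : forall x, vscal C1 x = x;
  vscal_assoc : forall a b x, vscal a (vscal b x) = vscal (Cmul a b) x;
  vscal_distr_v : forall a x y, vscal a (vadd x y) = vadd (vscal a x) (vscal a y);
  vscal_distr_s : forall a b x, vscal (Cadd a b) x = vadd (vscal a x) (vscal b x);
  inner_conj : forall x y, inner y x = Cconj (inner x y);
  inner_add_l : forall x y z, inner (vadd x y) z = Cadd (inner x z) (inner y z);
  inner_scal_l : forall a x y, inner (vscal a x) y = Cmul a (inner x y);
  inner_pos : forall x, Im (inner x x) = 0 /\ 0 <= Re (inner x x);
  inner_def : forall x, Re (inner x x) = 0 -> x = vzero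
}.

Arguments vzero {_}.
Arguments vadd {_}.
Arguments vopp {_}.
Arguments vscal {_}.
Arguments inner {_}.

Section HilbertDefs.
Variable H : PreHilbert.

Definition vsub (x y : H) : H := vadd x (vopp y).
Definition norm (x : H) : R := sqrt (Re (inner x x)).

Definition complete : Prop :=
  forall u : nat -> H,
    (forall eps, 0 < eps -> exists N, forall n m, (N <= n)%nat -> (N <= m)%nat ->
        norm (vsub (u n) (u m)) < eps) ->
    exists l : H, forall eps, 0 < eps -> exists N, forall n, (N <= n)%nat ->
        norm (vsub (u n) l) < eps.

Definition separable : Prop :=
  exists d : nat -> H, forall x eps, 0 < eps -> exists n, norm (vsub x (d n)) < eps.

Fixpoint lincomb (c : nat -> C) (b : nat -> H) (n : nat) : H :=
  match n with
  | O => vzero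
  | S k => vadd (lincomb c b k) (vscal (c k) (b k))
  end.

Definition infinite_dimensional : Prop :=
  forall (n : nat) (b : nat -> H), exists x : H,
    forall c : nat -> C, x <> lincomb c b n.

Record operator : Type := { dom : H -> Prop; app : H -> H }.

Definition linear_op (T : operator) : Prop :=
  dom T vzero /\
  (forall x y, dom T x -> dom T y -> dom T (vadd x y)) /\
  (forall a x, dom T x -> dom T (vscal a x)) /\
  (forall x y, dom T x -> dom T y -> app T (vadd x y) = vadd (app T x) (app T y)) /\
  (forall a x, dom T x -> app T (vscal a x) = vscal a (app T x)).

Definition densely_defined (T : operator) : Prop :=
  forall x eps, 0 < eps -> exists y, dom T y /\ norm (vsub x y) < eps.

(* T = T^* : T densely defined, symmetric, and dom T^* = dom T *)
Definition self_adjoint (T : operator) : Prop :=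
  linear_op T /\ densely_defined T /\
  (forall x y, dom T x -> dom T y -> inner (app T x) y = inner x (app T y)) /\
  (forall y, (exists z, forall x, dom T x -> inner (app T x) y = inner x z) -> dom T y).

Definition nonnegative (T : operator) : Prop :=
  forall x, dom T x -> 0 <= Re (inner (app T x) x).

Definition nonneg_self_adjoint (T : operator) : Prop :=
  self_adjoint T /\ nonnegative T.

Definition unbounded (T : operator) : Prop :=
  ~ exists c : R, forall x, dom T x -> norm (app T x) <= c * norm x.

Definition trivial_kernel (T : operator) : Prop :=
  forall x, dom T x -> app T x = vzero -> x = vzero.

(* S is the (unique) non-negative self-adjoint square root T^{1/2} of T:
   S nonneg self-adjoint and S S = T as operators (with domains). *)
Definition is_sqrt (S T : operator) : Prop :=
  nonneg_self_adjoint S /\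
  (forall x, dom T x <-> (dom S x /\ dom S (app S x))) /\
  (forall x, dom T x -> app S (app S x) = app T x).

End HilbertDefs.
Arguments norm {H}.
Arguments vsub {H}.

(* Main.v *)
(* Prescribing A = (1 + T1)^-1 and C = (1 + T2)^-1, the operator T must be given by
   (1 + T)^-1 = A + C: on D(T^{1/2}) with its graph norm, (A + C) h |-> (A h, C h)
   is an isometry into D(T1^{1/2}) + D(T2^{1/2}), and it is onto as soon as the two
   form domains meet trivially.  All the claims follow from that, so one has to find
   an injective C >= 0 with A + C <= 1 and D(T1^{1/2}) /\ ran C^{1/2} = {0}.

   Let B = (1 + T1^{1/2})^-1, so that D(T1^{1/2}) = ran B.  As T1 is unbounded, there
   are orthonormal e_j with |B e_j| <= 8^-j.  With r a map taking every value
   infinitely often, r(j) <= j, and (d_k) dense, put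
     P x = 1/4 (sum_j 2^-j (B x, d'_r(j)) e_j + sum_j 4^-j (x, e_j) e_r(j)),
   where d'_k = d_k / (1 + |d_k|).
   P is injective by density of (d_k).  If k = P^* y lies in ran B, then
   |(k, e_j)| = O(8^-j), whereas (k, e_j) = 4^-j (y, e_r(j)) / 4 + O(8^-j), so y is
   orthogonal to all e_n and k = 0.  Then C = (1 - B) P^* P (1 - B) works: an element
   (1 - B) k = B b of both form domains has k = B (b + k) in ran B.

   Square roots of self-adjoint operators are never constructed: a form domain is
   determined by its operator through resolvents, and if T1 had no square root the
   conclusion would be vacuous. *)
Require Import Defs.
From Stdlib Require Import Reals Lra Lia Classical ClassicalEpsilon.
Open Scope R_scope.

Lemma fun_choice (A B : Type) (P : A -> B -> Prop) :
  (forall x, exists y, P x y) -> exists f, forall x, P x (f x).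
Proof.
  intro h.
  exists (fun x => proj1_sig (constructive_indefinite_description _ (h x))).
  intro x. exact (proj2_sig (constructive_indefinite_description _ (h x))).
Qed.

(** * Hilbert space *)

Section Hilbert.
Variable H : PreHilbert.
Implicit Types (x y z w h : H) (F : H -> H).

(* The complex space is handled as a real Hilbert space (inner product [ip])
   with the isometry [vi] of multiplication by the imaginary unit. *)
Definition ip x y : R := Re (inner x y).
Definition rs (r : R) x : H := vscal (mkC r 0) x.
Definition vi x : H := vscal (mkC 0 1) x.
Definition nsq x : R := ip x x.

Lemma C_ext (a b : Defs.C) : Re a = Re b -> Im a = Im b -> a = b.
Proof. destruct a, b; simpl; intros -> ->; reflexivity. Qed.

Lemma ip_sym x y : ip x y = ip y x.
Proof. unfold ip. rewrite (inner_conj _ x y). reflexivity. Qed.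

Lemma ip_add_l x y z : ip (vadd x y) z = ip x z + ip y z.
Proof. unfold ip. rewrite inner_add_l. reflexivity. Qed.

Lemma ip_add_r x y z : ip z (vadd x y) = ip z x + ip z y.
Proof. rewrite ip_sym, ip_add_l, !(ip_sym z). reflexivity. Qed.

Lemma ip_rs_l r x y : ip (rs r x) y = r * ip x y.
Proof. unfold ip, rs. rewrite inner_scal_l. simpl. ring. Qed.

Lemma ip_rs_r r x y : ip y (rs r x) = r * ip y x.
Proof. rewrite ip_sym, ip_rs_l, (ip_sym y). reflexivity. Qed.

Lemma ip_0_l y : ip vzero y = 0.
Proof.
  assert (e : ip (vadd vzero vzero) y = ip vzero y) by (rewrite vadd_0; reflexivity).
  rewrite ip_add_l in e. lra.
Qed.

Lemma ip_0_r y : ip y vzero = 0.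
Proof. rewrite ip_sym. apply ip_0_l. Qed.

Lemma ip_opp_l x y : ip (vopp x) y = - ip x y.
Proof.
  assert (e := ip_0_l y). rewrite <- (vadd_opp _ x), ip_add_l in e. lra.
Qed.

Lemma ip_opp_r x y : ip y (vopp x) = - ip y x.
Proof. rewrite ip_sym, ip_opp_l, (ip_sym y). reflexivity. Qed.

Lemma ip_sub_l x y z : ip (vsub x y) z = ip x z - ip y z.
Proof. unfold vsub. rewrite ip_add_l, ip_opp_l. ring. Qed.

Lemma ip_sub_r x y z : ip z (vsub x y) = ip z x - ip z y.
Proof. unfold vsub. rewrite ip_add_r, ip_opp_r. ring. Qed.

(** With [C_ext], an identity of complex inner products splits into two real ones, the second
    obtained by replacing [x] with [vi x]. *)
Lemma Im_inner x y : Im (inner x y) = - ip (vi x) y.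
Proof. unfold ip, vi. rewrite inner_scal_l. simpl. ring. Qed.

Lemma ip_vi_l x y : ip (vi x) y = - ip x (vi y).
Proof.
  assert (e : Im (inner x y) = - Im (inner y x)) by (rewrite (inner_conj _ x y); simpl; ring).
  rewrite !Im_inner, (ip_sym (vi y)) in e. lra.
Qed.

Lemma nsq_ge0 x : 0 <= nsq x.
Proof. apply (proj2 (inner_pos H x)). Qed.

Lemma nsq_eq0 x : nsq x = 0 -> x = vzero.
Proof. apply inner_def. Qed.

Lemma vsub_eq0 x y : vsub x y = vzero -> x = y.
Proof.
  intro e. rewrite <- (vadd_0 _ x), <- (vadd_opp _ y), (vadd_comm _ y).
  rewrite vadd_assoc. unfold vsub in e. rewrite e, vadd_comm, vadd_0. reflexivity.
Qed.

Lemma ip_ext x y : (forall w, ip x w = ip y w) -> x = y.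
Proof.
  intro e. apply vsub_eq0, nsq_eq0. unfold nsq.
  rewrite ip_sub_l, e. ring.
Qed.

Lemma vi_add x y : vi (vadd x y) = vadd (vi x) (vi y).
Proof. apply vscal_distr_v. Qed.

Lemma vi_rs r x : vi (rs r x) = rs r (vi x).
Proof.
  unfold vi, rs. rewrite !vscal_assoc. f_equal. apply C_ext; simpl; ring.
Qed.

Lemma vi_vi x : vi (vi x) = vopp x.
Proof.
  apply ip_ext; intro w. rewrite ip_opp_l. unfold vi, ip.
  rewrite !inner_scal_l. simpl. ring.
Qed.

Lemma vi_opp x : vi (vopp x) = vopp (vi x).
Proof.
  apply ip_ext; intro w. rewrite ip_vi_l, !ip_opp_l, ip_vi_l. ring.
Qed.

Lemma vi_sub x y : vi (vsub x y) = vsub (vi x) (vi y).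
Proof. unfold vsub. rewrite vi_add, vi_opp. reflexivity. Qed.

Lemma vi_0 : vi vzero = vzero.
Proof. apply ip_ext; intro w. rewrite ip_vi_l, !ip_0_l. ring. Qed.

Lemma vscal_rs_vi (a : Defs.C) x : vscal a x = vadd (rs (Re a) x) (rs (Im a) (vi x)).
Proof.
  unfold rs, vi. rewrite vscal_assoc, <- vscal_distr_s. f_equal.
  apply C_ext; simpl; ring.
Qed.

(** [vexp] moves [vi] inwards and expands [ip] by real bilinearity. [vec] pairs both sides of a
    vector identity with an arbitrary vector, which leaves an identity of reals. *)
Ltac vexp := repeat rewrite ?vi_add, ?vi_sub, ?vi_opp, ?vi_rs, ?vi_vi, ?vi_0;
  repeat rewrite ?ip_add_l, ?ip_add_r, ?ip_sub_l, ?ip_sub_r, ?ip_opp_l, ?ip_opp_r,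
    ?ip_rs_l, ?ip_rs_r, ?ip_0_l, ?ip_0_r.
Ltac vec := apply ip_ext; let w := fresh "w" in intro w; vexp; try (ring || field; lra).

Lemma vi_vi_ip x y : ip (vi x) (vi y) = ip x y.
Proof. rewrite ip_vi_l, vi_vi, ip_opp_r. ring. Qed.

Lemma ip_vi_self x : ip x (vi x) = 0.
Proof. assert (e := ip_vi_l x x). rewrite ip_sym in e. lra. Qed.

Lemma rs_1 x : rs 1 x = x.
Proof. vec. Qed.

Lemma rs_opp1 x : rs (-1) x = vopp x.
Proof. vec. Qed.

Lemma nsq_sub x y : nsq (vsub x y) = nsq x - 2 * ip x y + nsq y.
Proof. unfold nsq. vexp. rewrite (ip_sym y x). ring. Qed.

Lemma nsq_add x y : nsq (vadd x y) = nsq x + 2 * ip x y + nsq y.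
Proof. unfold nsq. vexp. rewrite (ip_sym y x). ring. Qed.

Lemma nsq_rs r x : nsq (rs r x) = r * r * nsq x.
Proof. unfold nsq. vexp. ring. Qed.

Lemma nsq_vi x : nsq (vi x) = nsq x.
Proof. apply vi_vi_ip. Qed.

(** * Norm estimates and the Cauchy-Schwarz inequality *)

Lemma norm_ge0 x : 0 <= norm x.
Proof. apply sqrt_pos. Qed.

Lemma norm_sq x : norm x * norm x = nsq x.
Proof. apply sqrt_sqrt, nsq_ge0. Qed.

Lemma sq_le_le a b : 0 <= b -> a * a <= b * b -> a <= b.
Proof. intros. nra. Qed.

Lemma norm_le x (r : R) : 0 <= r -> nsq x <= r * r -> norm x <= r.
Proof. intros h1 h2. apply sq_le_le; [lra|]. rewrite norm_sq. lra. Qed.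

Lemma nsq_le x (r : R) : norm x <= r -> nsq x <= r * r.
Proof. intro h. rewrite <- norm_sq. assert (h1 := norm_ge0 x). nra. Qed.

Lemma norm_le_nsq x y : nsq x <= nsq y -> norm x <= norm y.
Proof. apply sqrt_le_1_alt. Qed.

(** Besides Cauchy-Schwarz this serves variational arguments: with [a = 0] it forces the linear
    coefficient [b] to vanish. *)
Lemma quad_discr (a b c : R) :
  (forall t, 0 <= a + 2 * t * b + t * t * c) -> b * b <= a * c.
Proof.
  intro h. assert (h0 := h 0).
  destruct (Rle_lt_dec c 0) as [hc|hc].
  - assert (b = 0).
    { destruct (Req_dec b 0) as [|nb]; [assumption|exfalso].
      (* This [t] turns the linear term into [-(a + 1)], so the total is at most -1 because
         [c <= 0]. *)
      assert (e := h (- (a + 1) / (2 * b))).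
      replace (2 * (- (a + 1) / (2 * b)) * b) with (- (a + 1)) in e by (field; lra).
      set (t := - (a + 1) / (2 * b)) in *. nra. }
    subst b. assert (c = 0 \/ c < 0) as [->|] by lra; [lra|].
    (* Now [b = 0] and [c < 0]. As [t >= 1] and [t * (- c) = a + 1 - c], the total is at most
       [c - 1]. *)
    exfalso. assert (e := h ((a + 1 - c) / - c)).
    set (t := (a + 1 - c) / - c) in *.
    assert (t * (- c) = a + 1 - c) by (unfold t; field; lra).
    assert (1 <= t) by nra. nra.
  - assert (e := h (- b / c)).
    replace (a + 2 * (- b / c) * b + - b / c * (- b / c) * c)
      with ((a * c - b * b) / c) in e by (field; lra).
    assert (0 <= (a * c - b * b) / c * c) by nra.
    replace ((a * c - b * b) / c * c) with (a * c - b * b) in * by (field; lra). lra.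
Qed.

Lemma cauchy_schwarz_sq x y : ip x y * ip x y <= nsq x * nsq y.
Proof.
  apply quad_discr. intro t. assert (e := nsq_ge0 (vadd x (rs t y))).
  rewrite nsq_add, nsq_rs, ip_rs_r in e. lra.
Qed.

Lemma cauchy_schwarz x y : Rabs (ip x y) <= norm x * norm y.
Proof.
  assert (h1 := norm_ge0 x). assert (h2 := norm_ge0 y).
  apply sq_le_le; [nra|]. rewrite <- Rabs_mult, Rabs_pos_eq by nra.
  replace (norm x * norm y * (norm x * norm y)) with
    ((norm x * norm x) * (norm y * norm y)) by ring.
  rewrite !norm_sq. apply cauchy_schwarz_sq.
Qed.

Lemma ip_le x y : ip x y <= norm x * norm y.
Proof. assert (h := cauchy_schwarz x y). assert (h1 := Rle_abs (ip x y)). lra. Qed.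

Lemma norm_add x y : norm (vadd x y) <= norm x + norm y.
Proof.
  assert (h1 := norm_ge0 x). assert (h2 := norm_ge0 y).
  apply norm_le; [lra|]. rewrite nsq_add, <- !norm_sq.
  assert (h := ip_le x y). nra.
Qed.

Lemma norm_opp x : norm (vopp x) = norm x.
Proof.
  unfold norm. f_equal. change (nsq (vopp x) = nsq x). unfold nsq. vexp. ring.
Qed.

Lemma norm_sub x y : norm (vsub x y) <= norm x + norm y.
Proof. unfold vsub. rewrite <- (norm_opp y). apply norm_add. Qed.

Lemma norm_sub_sym x y : norm (vsub x y) = norm (vsub y x).
Proof. rewrite <- norm_opp. f_equal. vec. Qed.

Lemma norm_tri x y z : norm (vsub x z) <= norm (vsub x y) + norm (vsub y z).
Proof. replace (vsub x z) with (vadd (vsub x y) (vsub y z)) by vec. apply norm_add. Qed.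

Lemma norm_rs r x : norm (rs r x) = Rabs r * norm x.
Proof.
  unfold norm. fold (ip (rs r x) (rs r x)) (ip x x).
  fold (nsq (rs r x)) (nsq x). rewrite nsq_rs, sqrt_mult_alt by nra.
  f_equal. apply sqrt_Rsqr_abs.
Qed.

Lemma norm_vi x : norm (vi x) = norm x.
Proof. unfold norm. f_equal. apply nsq_vi. Qed.

Lemma norm_0 : norm (vzero : H) = 0.
Proof. unfold norm. fold (ip (vzero : H) vzero). rewrite ip_0_l. apply sqrt_0. Qed.

Lemma norm_eq0 x : norm x <= 0 -> x = vzero.
Proof.
  intro h. apply nsq_eq0. rewrite <- norm_sq. assert (h1 := norm_ge0 x). nra.
Qed.

(** * Complex-linear maps and convergent sequences *)

Definition lin F : Prop :=
  (forall x y, F (vadd x y) = vadd (F x) (F y)) /\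
  (forall r x, F (rs r x) = rs r (F x)) /\
  (forall x, F (vi x) = vi (F x)).

Lemma lin_opp F x : lin F -> F (vopp x) = vopp (F x).
Proof. intros [_ [h _]]. rewrite <- !rs_opp1. apply h. Qed.

Lemma lin_sub F x y : lin F -> F (vsub x y) = vsub (F x) (F y).
Proof. intros h. unfold vsub. rewrite <- (lin_opp F y h). apply h. Qed.

Lemma lin_0 F : lin F -> F vzero = vzero.
Proof.
  intros [_ [h _]]. replace (vzero : H) with (rs 0 (vzero : H)) by vec.
  rewrite h. vec.
Qed.

Definition cvg (u : nat -> H) (l : H) : Prop :=
  forall eps, 0 < eps -> exists N, forall n, (N <= n)%nat -> norm (vsub (u n) l) < eps.

Definition cauchy (u : nat -> H) : Prop :=
  forall eps, 0 < eps -> exists N, forall n m, (N <= n)%nat -> (N <= m)%nat ->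
    norm (vsub (u n) (u m)) < eps.

Lemma cvg_const x : cvg (fun _ => x) x.
Proof.
  intros eps he. exists 0%nat. intros n _. replace (vsub x x) with (vzero : H) by vec.
  rewrite norm_0. exact he.
Qed.

Lemma cvg_cauchy u l : cvg u l -> cauchy u.
Proof.
  intros h eps he. destruct (h (eps / 2)) as [N hN]; [lra|].
  exists N. intros n m hn hm. apply Rle_lt_trans with (1 := norm_tri _ l _).
  rewrite (norm_sub_sym l). assert (h1 := hN n hn). assert (h2 := hN m hm). lra.
Qed.

Lemma cvg_lipschitz (G : H -> H) K u l :
  (forall x y, norm (vsub (G x) (G y)) <= K * norm (vsub x y)) ->
  cvg u l -> cvg (fun n => G (u n)) (G l).
Proof.
  intros hG h eps he. assert (hK : 0 < 1 + Rabs K) by (assert (e := Rabs_pos K); lra).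
  destruct (h (eps / (1 + Rabs K))) as [N hN]; [apply Rdiv_lt_0_compat; lra|].
  exists N. intros n hn. assert (e := hN n hn).
  apply Rle_lt_trans with (1 := hG _ _).
  assert (e1 := norm_ge0 (vsub (u n) l)). assert (e2 := Rle_abs K).
  apply Rle_lt_trans with ((1 + Rabs K) * norm (vsub (u n) l)); [nra|].
  replace eps with ((1 + Rabs K) * (eps / (1 + Rabs K))) by (field; lra).
  apply Rmult_lt_compat_l; assumption.
Qed.

Lemma cvg_add u v l m : cvg u l -> cvg v m -> cvg (fun n => vadd (u n) (v n)) (vadd l m).
Proof.
  intros hu hv eps he. destruct (hu (eps / 2)) as [N hN]; [lra|].
  destruct (hv (eps / 2)) as [M hM]; [lra|]. exists (max N M). intros n hn.
  replace (vsub (vadd (u n) (v n)) (vadd l m))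
    with (vadd (vsub (u n) l) (vsub (v n) m)) by vec.
  apply Rle_lt_trans with (1 := norm_add _ _).
  assert (h1 := hN n ltac:(lia)). assert (h2 := hM n ltac:(lia)). lra.
Qed.

Lemma cvg_sub u v l m : cvg u l -> cvg v m -> cvg (fun n => vsub (u n) (v n)) (vsub l m).
Proof.
  intros hu hv. unfold vsub. apply cvg_add with (1 := hu).
  apply cvg_lipschitz with (K := 1) (G := @vopp H); [|exact hv].
  intros x y. replace (vsub (vopp x) (vopp y)) with (vopp (vsub x y)) by vec.
  rewrite norm_opp. lra.
Qed.

Lemma cvg_norm_le u x l r : cvg u l -> (forall n, norm (vsub (u n) x) <= r) ->
  norm (vsub l x) <= r.
Proof.
  intros h hr. apply le_epsilon. intros eps he. destruct (h eps he) as [N hN].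
  assert (h1 := hN N (le_n N)). assert (h2 := hr N). rewrite norm_sub_sym in h1.
  assert (h3 := norm_tri l (u N) x). lra.
Qed.

Lemma cvg_unique u l m : cvg u l -> cvg u m -> l = m.
Proof.
  intros h1 h2. apply vsub_eq0, norm_eq0, le_epsilon. intros eps he.
  destruct (h1 (eps / 2)) as [N hN]; [lra|]. destruct (h2 (eps / 2)) as [M hM]; [lra|].
  assert (e1 := hN (max N M) ltac:(lia)). assert (e2 := hM (max N M) ltac:(lia)).
  assert (e := norm_tri l (u (max N M)) m). rewrite norm_sub_sym in e1. lra.
Qed.

Lemma cvg_ip u v l m : cvg u l -> cvg v m -> Un_cv (fun n => ip (u n) (v n)) (ip l m).
Proof.
  intros hu hv eps he.
  set (K := norm l + norm m + 1).
  assert (hl := norm_ge0 l). assert (hm := norm_ge0 m).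
  assert (hK : 1 <= K) by (unfold K; lra).
  (* [d <= 1] bounds [norm (v n)] by [norm m + 1], so the two error terms add up to at most
     [d * K <= eps / 2]. *)
  set (d := Rmin 1 (eps / (2 * K))).
  assert (hd0 : 0 < eps / (2 * K)) by (apply Rdiv_lt_0_compat; lra).
  assert (hd : 0 < d) by (apply Rmin_glb_lt; lra).
  assert (hd1 : d <= 1) by apply Rmin_l.
  assert (hd2 : 2 * K * d <= eps).
  { apply Rle_trans with (2 * K * (eps / (2 * K))).
    - apply Rmult_le_compat_l; [lra|apply Rmin_r].
    - right. field. lra. }
  destruct (hu d hd) as [N hN]. destruct (hv d hd) as [M hM].
  exists (max N M). intros n hn. unfold R_dist.
  assert (e1 := hN n ltac:(lia)). assert (e2 := hM n ltac:(lia)).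
  replace (ip (u n) (v n) - ip l m)
    with (ip (vsub (u n) l) (v n) + ip l (vsub (v n) m)) by (vexp; ring).
  assert (e3 := Rabs_triang (ip (vsub (u n) l) (v n)) (ip l (vsub (v n) m))).
  assert (e4 := cauchy_schwarz (vsub (u n) l) (v n)).
  assert (e5 := cauchy_schwarz l (vsub (v n) m)).
  assert (e6 : norm (v n) <= norm m + d).
  { replace (v n) with (vadd m (vsub (v n) m)) at 1 by vec.
    apply Rle_trans with (1 := norm_add _ _). lra. }
  assert (e7 := norm_ge0 (v n)).
  assert (e8 := norm_ge0 (vsub (u n) l)). assert (e9 := norm_ge0 (vsub (v n) m)).
  assert (norm (vsub (u n) l) * norm (v n) <= norm (vsub (u n) l) * (norm m + 1)) by nra.
  assert (norm (vsub (u n) l) * (norm m + 1) <= d * (norm m + 1)) by nra.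
  assert (norm l * norm (vsub (v n) m) <= norm l * d) by nra.
  assert (d * K + d * K <= eps) by lra.
  assert (0 < d * K) by nra.
  unfold K in *. nra.
Qed.

Lemma Un_cv_const (c : R) : Un_cv (fun _ => c) c.
Proof.
  intros eps he. exists 0%nat. intros n _. unfold R_dist.
  rewrite Rminus_diag, Rabs_R0. exact he.
Qed.

Lemma Un_cv_le (u v : nat -> R) l m :
  (forall n, u n <= v n) -> Un_cv u l -> Un_cv v m -> l <= m.
Proof. intros. apply Rle_cv_lim with u v; assumption. Qed.

Lemma Un_cv_eq (u v : nat -> R) l m :
  (forall n, u n = v n) -> Un_cv u l -> Un_cv v m -> l = m.
Proof.
  intros h h1 h2. apply Rle_antisym; [apply Un_cv_le with u v|apply Un_cv_le with v u];
  auto; intro n; rewrite h; lra.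
Qed.


(** * Consequences of completeness: Riesz representation, density, adjoints *)

Hypothesis Hcomplete : complete H.

Lemma cauchy_cvg u : cauchy u -> exists l, cvg u l.
Proof. exact (Hcomplete u). Qed.

(** Typically [v n] is [S (u n)]: whatever is controlled by a graph norm is Cauchy along a sequence
    that converges in it. *)
Lemma cauchy_of_nsq_le (u v w : nat -> H) :
  (forall n m, nsq (vsub (w n) (w m)) <= nsq (vsub (u n) (u m)) + nsq (vsub (v n) (v m))) ->
  cauchy u -> cauchy v -> cauchy w.
Proof.
  intros h hu hv eps he. destruct (hu (eps / 2)) as [N hN]; [lra|].
  destruct (hv (eps / 2)) as [M hM]; [lra|]. exists (max N M). intros n m hn hm.
  assert (h1 := hN n m ltac:(lia) ltac:(lia)). assert (h2 := hM n m ltac:(lia) ltac:(lia)).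
  assert (h3 := h n m). rewrite <- !norm_sq in h3.
  assert (p1 := norm_ge0 (vsub (u n) (u m))). assert (p2 := norm_ge0 (vsub (v n) (v m))).
  apply Rle_lt_trans with (norm (vsub (u n) (u m)) + norm (vsub (v n) (v m))); [|lra].
  apply sq_le_le; nra.
Qed.

Definition subspace (D : H -> Prop) : Prop :=
  D vzero /\ (forall x y, D x -> D y -> D (vadd x y)) /\ (forall r x, D x -> D (rs r x)).

Lemma inv_S_lt eps : 0 < eps -> exists N, forall n, (N <= n)%nat -> / INR (S n) < eps.
Proof.
  intro he. destruct (archimed_cor1 eps he) as [N [h1 h2]].
  exists N. intros n hn. apply Rle_lt_trans with (2 := h1).
  apply Rinv_le_contravar; [apply lt_0_INR; lia|apply le_INR; lia].
Qed.

Lemma inv_S_pos n : 0 < / INR (S n).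
Proof. apply Rinv_0_lt_compat, lt_0_INR. lia. Qed.

(* The representing vector is the limit of a sequence minimising
   [nsq w - 2 * phi w] on [D]; [D] need not be closed. *)
Lemma riesz (D : H -> Prop) (phi : H -> R) (M : R) :
  subspace D ->
  (forall x y, D x -> D y -> phi (vadd x y) = phi x + phi y) ->
  (forall r x, D x -> phi (rs r x) = r * phi x) ->
  (forall x, D x -> phi x <= M * norm x) ->
  exists z, (exists u, (forall n : nat, D (u n)) /\ cvg u z) /\
    forall w, D w -> phi w = ip z w.
Proof.
  intros [D0 [Dadd Drs]] padd prs pM.
  set (J := fun w => nsq w - 2 * phi w).
  assert (lb : forall w, D w -> - (M * M) <= J w).
  { intros w hw. unfold J. rewrite <- norm_sq. assert (e := pM w hw).
    assert (e1 := Rle_0_sqr (norm w - M)). unfold Rsqr in e1. lra. }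
  set (E := fun r => exists w, D w /\ r = - J w).
  assert (bE : bound E).
  { exists (M * M). intros r [w [hw ->]]. assert (e := lb w hw). lra. }
  assert (nE : exists r, E r).
  { exists (- J vzero), vzero. auto. }
  destruct (completeness E bE nE) as [m lubm]. destruct lubm as [ub lub].
  assert (inf : forall w, D w -> - m <= J w).
  { intros w hw. assert (e : - J w <= m) by (apply ub; exists w; auto). lra. }
  assert (ex : forall n, exists w, D w /\ J w <= - m + / INR (S n)).
  { intro n. apply NNPP. intro no. assert (e := inv_S_pos n).
    assert (m <= m - / INR (S n)); [|lra]. apply lub. intros r [w [hw ->]].
    destruct (Rle_lt_dec (J w) (- m + / INR (S n))) as [l|l]; [|lra].
    exfalso. apply no. eauto. }
  destruct (fun_choice _ _ _ ex) as [u hu].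
  assert (cu : cauchy u).
  { intros eps he. destruct (inv_S_lt (eps * eps / 4)) as [N hN]; [nra|].
    exists N. intros p q hp hq.
    destruct (hu p) as [hup jp]. destruct (hu q) as [huq jq].
    assert (e1 := hN p hp). assert (e2 := hN q hq).
    (* Parallelogram law: [J] is at least [- m] at the midpoint, so the squared distance is at most
       [2 / (p + 1) + 2 / (q + 1)]. *)
    assert (e3 := inf (rs (/2) (vadd (u p) (u q))) ltac:(auto)).
    unfold J in *. rewrite prs, padd, nsq_rs, nsq_add in e3 by auto.
    assert (e4 := nsq_sub (u p) (u q)).
    assert (e5 : nsq (vsub (u p) (u q)) < eps * eps) by lra.
    rewrite <- norm_sq in e5. assert (e6 := norm_ge0 (vsub (u p) (u q))). nra. }
  destruct (cauchy_cvg u cu) as [z hz]. exists z. split.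
  { exists u. split; [apply hu|exact hz]. }
  intros w hw.
  (* The limit of [J (u n + t w) >= - m] against [J (u n) <= - m + 1 / (n + 1)]; then [quad_discr]
     kills the linear coefficient. *)
  assert (var : forall t, 0 <= 0 + 2 * t * (ip z w - phi w) + t * t * nsq w).
  { intro t. assert (cv := cvg_ip _ _ _ _ hz (cvg_const w)).
    assert (cv1 : Un_cv (fun n => / INR (S n)) 0).
    { intros eps he. destruct (inv_S_lt eps he) as [N hN]. exists N. intros n hn.
      unfold R_dist. rewrite Rminus_0_r, Rabs_pos_eq by (left; apply inv_S_pos). auto. }
    assert (cv2 := CV_plus _ _ _ _ cv1 (CV_mult _ _ _ _ (Un_cv_const (2 * t)) cv)).
    assert (cv3 := CV_plus _ _ _ _ cv2 (Un_cv_const (- 2 * t * phi w + t * t * nsq w))).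
    simpl in cv3.
    enough (0 <= 0 + 2 * t * ip z w + (-2 * t * phi w + t * t * nsq w)) by lra.
    apply Un_cv_le with (2 := Un_cv_const 0) (3 := cv3). intro n. destruct (hu n) as [hun jn].
    assert (e1 := inf (vadd (u n) (rs t w)) ltac:(auto)). unfold J in *.
    rewrite padd, prs, nsq_add, nsq_rs, ip_rs_r in e1 by auto.
    change (0 <= / INR (S n) + 2 * t * ip (u n) w + (-2 * t * phi w + t * t * nsq w)). lra. }
  assert (e := quad_discr _ _ _ var). nra.
Qed.

(** Riesz on [D] projects [x] onto the closure of [D], and the residual is orthogonal to [D]. *)
Lemma subspace_dense (D : H -> Prop) : subspace D ->
  (forall z, (forall w, D w -> ip z w = 0) -> z = vzero) ->
  forall x, exists u, (forall n : nat, D (u n)) /\ cvg u x.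
Proof.
  intros hD h x. destruct (riesz D (fun w => ip x w) (norm x) hD) as [z [hu hz]].
  - intros. apply ip_add_r.
  - intros. apply ip_rs_r.
  - intros. apply ip_le.
  - replace x with z; [exact hu|]. symmetry. apply vsub_eq0, h.
    intros w hw. rewrite ip_sub_l, (hz w hw). ring.
Qed.

Lemma adjoint_exists (Q : H -> H) : lin Q -> (forall x, norm (Q x) <= norm x) ->
  exists Q', lin Q' /\ (forall x, norm (Q' x) <= norm x) /\
    forall x y, ip (Q' x) y = ip x (Q y).
Proof.
  intros lQ bQ.
  destruct (fun_choice H H (fun x z => forall y, ip z y = ip x (Q y))) as [Q' hQ'].
  { intro x. destruct (riesz (fun _ => True) (fun y => ip x (Q y)) (norm x)) as [z [_ hz]].
    - repeat split.
    - intros. rewrite (proj1 lQ). apply ip_add_r.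
    - intros. rewrite (proj1 (proj2 lQ)). apply ip_rs_r.
    - intros y _. assert (e := ip_le x (Q y)). assert (e1 := bQ y).
      assert (e2 := norm_ge0 x). nra.
    - exists z. intro y. symmetry. apply hz. exact I. }
  exists Q'. split; [|split; [|exact hQ']].
  - repeat split; intros; apply ip_ext; intro w; vexp; rewrite ?hQ'; vexp; rewrite ?hQ'; try ring.
    rewrite !ip_vi_l, hQ', (proj2 (proj2 lQ)). reflexivity.
  - intro x. assert (e : nsq (Q' x) = ip x (Q (Q' x))) by apply hQ'.
    rewrite <- norm_sq in e. assert (e1 := ip_le x (Q (Q' x))). assert (e2 := bQ (Q' x)).
    assert (e3 := norm_ge0 x). assert (e4 := norm_ge0 (Q' x)).
    destruct (Rle_lt_dec (norm (Q' x)) (norm x)) as [l|l]; [exact l|exfalso]. nra.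
Qed.

(** * Non-negative self-adjoint operators *)

(* [nonneg_self_adjoint] in terms of [ip] and [vi]; see [psa_iff]. *)
Definition psa (T : operator H) : Prop :=
  subspace (dom T) /\ (forall x, dom T x -> dom T (vi x)) /\
  (forall x y, dom T x -> dom T y -> app T (vadd x y) = vadd (app T x) (app T y)) /\
  (forall r x, dom T x -> app T (rs r x) = rs r (app T x)) /\
  (forall x, dom T x -> app T (vi x) = vi (app T x)) /\
  (forall x, exists u, (forall n : nat, dom T (u n)) /\ cvg u x) /\
  (forall x y, dom T x -> dom T y -> ip (app T x) y = ip x (app T y)) /\
  (forall y z, (forall x, dom T x -> ip (app T x) y = ip x z) -> dom T y) /\
  (forall x, dom T x -> 0 <= ip (app T x) x).

Lemma psa_iff T : nonneg_self_adjoint T <-> psa T.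
Proof.
  split.
  - intros [[[d0 [da [ds [aa as_]]]] [dd [sym adj]]] pos].
    unfold psa, subspace, rs, vi. repeat split; auto.
    + intro x. destruct (fun_choice nat H (fun n y => dom T y /\ norm (vsub y x) < / INR (S n)))
        as [u hu].
      { intro n. destruct (dd x _ (inv_S_pos n)) as [y [h1 h2]]. exists y.
        rewrite norm_sub_sym. auto. }
      exists u. split; [apply hu|]. intros eps he. destruct (inv_S_lt eps he) as [N hN].
      exists N. intros n hn. apply Rlt_trans with (2 := hN n hn). apply hu.
    + intros x y hx hy. unfold ip. rewrite sym; auto.
    (* The hypothesis concerns real parts; at [vi x] it yields the imaginary part. *)
    + intros y z h. apply adj. exists z. intros x hx. apply C_ext; [apply h, hx|].
      rewrite !Im_inner. f_equal. unfold vi. rewrite <- as_ by exact hx. apply h. auto.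
  - intros [[d0 [da ds]] [dv [aa [ar [av [dd [sym [adj pos]]]]]]]].
    assert (dsc : forall a x, dom T x -> dom T (vscal a x)).
    { intros a x hx. rewrite vscal_rs_vi. auto. }
    assert (asc : forall a x, dom T x -> app T (vscal a x) = vscal a (app T x)).
    { intros a x hx. rewrite !vscal_rs_vi, aa, !ar, av; auto. }
    split; [split; [|split; [|split]]|].
    + repeat split; auto.
    + intros x eps he. destruct (dd x) as [u [h1 h2]]. destruct (h2 eps he) as [N hN].
      exists (u N). split; [auto|]. rewrite norm_sub_sym. apply hN. lia.
    + intros x y hx hy. apply C_ext; [apply sym; auto|].
      rewrite !Im_inner, <- av by exact hx. f_equal. apply sym; auto.
    + intros y [z hz]. apply (adj y z). intros x hx. unfold ip. rewrite hz; auto.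
    + intros x hx. apply pos, hx.
Qed.

Section Psa.
Variable T : operator H.
Hypothesis hT : psa T.

Lemma psa_dom_0 : dom T vzero.
Proof. apply hT. Qed.

Lemma psa_dom_add x y : dom T x -> dom T y -> dom T (vadd x y).
Proof. apply hT. Qed.

Lemma psa_app_add x y : dom T x -> dom T y -> app T (vadd x y) = vadd (app T x) (app T y).
Proof. apply hT. Qed.

Lemma psa_dom_vi x : dom T x -> dom T (vi x).
Proof. apply hT. Qed.

Lemma psa_app_vi x : dom T x -> app T (vi x) = vi (app T x).
Proof. apply hT. Qed.

Lemma psa_sub x y : dom T x -> dom T y -> dom T (vsub x y).
Proof.
  intros hx hy. destruct hT as [[d0 [da ds]] _]. unfold vsub. rewrite <- rs_opp1. auto.
Qed.

Lemma psa_app_sub x y : dom T x -> dom T y -> app T (vsub x y) = vsub (app T x) (app T y).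
Proof.
  intros hx hy. destruct hT as [[d0 [da ds]] [dv [aa [ar _]]]].
  unfold vsub. rewrite <- !rs_opp1, aa, ar; auto.
Qed.

Lemma psa_app_0 : app T vzero = vzero.
Proof.
  destruct hT as [[d0 [da ds]] [dv [aa [ar _]]]].
  replace (vzero : H) with (rs 0 (vzero : H)) by vec. rewrite ar by exact d0. vec.
Qed.

Lemma psa_ortho_dom z : (forall x, dom T x -> ip x z = 0) -> z = vzero.
Proof.
  intro h. destruct hT as [_ [_ [_ [_ [_ [dd _]]]]]]. destruct (dd z) as [u [h1 h2]].
  apply nsq_eq0. symmetry. eapply Un_cv_eq; [|apply (Un_cv_const 0)|].
  2: exact (cvg_ip _ _ _ _ h2 (cvg_const z)).
  intro n. simpl. rewrite h; auto.
Qed.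

Lemma psa_adj y z : (forall x, dom T x -> ip (app T x) y = ip x z) -> dom T y /\ app T y = z.
Proof.
  intro h. destruct hT as [_ [_ [_ [_ [_ [_ [sym [adj _]]]]]]]].
  assert (hy := adj y z h). split; [exact hy|].
  apply vsub_eq0, psa_ortho_dom. intros x hx. rewrite ip_sub_r, <- sym, h by auto. ring.
Qed.

(** Adjoints are closed: the symmetry relation passes to the limit. *)
Lemma psa_closed u x z : (forall n, dom T (u n)) -> cvg u x -> cvg (fun n => app T (u n)) z ->
  dom T x /\ app T x = z.
Proof.
  intros hu h1 h2. destruct hT as [_ [_ [_ [_ [_ [_ [sym _]]]]]]].
  apply psa_adj. intros w hw. eapply Un_cv_eq; [|exact (cvg_ip _ _ _ _ (cvg_const (app T w)) h1)|
    exact (cvg_ip _ _ _ _ (cvg_const w) h2)].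
  intro n. simpl. apply sym; auto.
Qed.

(** This stands in for weak compactness: [ip (T w) x] is the limit of [ip w (T (u n))], hence
    bounded by [M * norm w], and Riesz puts [x] into the domain of the adjoint. *)
Lemma psa_dom_of_bounded u x M : (forall n, dom T (u n)) -> cvg u x ->
  (forall n, norm (app T (u n)) <= M) -> dom T x.
Proof.
  intros hu h1 h2. destruct hT as [sD [_ [aa [ar [_ [_ [sym [adj _]]]]]]]].
  destruct (riesz (dom T) (fun w => ip (app T w) x) M sD) as [z [_ hz]].
  - intros. rewrite aa by auto. apply ip_add_l.
  - intros. rewrite ar by auto. apply ip_rs_l.
  - intros w hw. eapply Un_cv_le; [|exact (cvg_ip _ _ _ _ (cvg_const (app T w)) h1)|
      apply (Un_cv_const (M * norm w))].
    intro n. simpl. rewrite sym by auto. assert (e := ip_le w (app T (u n))).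
    assert (e1 := h2 n). assert (e2 := norm_ge0 w). nra.
  - apply (adj x z). intros w hw. rewrite (hz w hw). apply ip_sym.
Qed.

(** The cross term of the square is [2 l (T x, x) >= 0]. *)
Lemma psa_resolvent_bound l x : 0 <= l -> dom T x ->
  nsq x + l * l * nsq (app T x) <= nsq (vadd x (rs l (app T x))).
Proof.
  intros hl hx. destruct hT as [_ [_ [_ [_ [_ [_ [_ [_ pos]]]]]]]].
  rewrite nsq_add, nsq_rs, ip_rs_r, ip_sym. assert (e := pos x hx). nra.
Qed.

Lemma psa_resolvent_inj l x y : 0 <= l -> dom T x -> dom T y ->
  vadd x (rs l (app T x)) = vadd y (rs l (app T y)) -> x = y.
Proof.
  intros hl hx hy e. apply vsub_eq0, nsq_eq0. apply Rle_antisym; [|apply nsq_ge0].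
  assert (b := psa_resolvent_bound l _ hl (psa_sub _ _ hx hy)).
  rewrite psa_app_sub in b by auto.
  replace (vadd (vsub x y) (rs l (vsub (app T x) (app T y)))) with (vzero : H) in b.
  - assert (e1 := nsq_ge0 (vsub (app T x) (app T y))).
    unfold nsq at 3 in b. rewrite ip_0_l in b. nra.
  - symmetry. replace (vadd (vsub x y) (rs l (vsub (app T x) (app T y))))
      with (vsub (vadd x (rs l (app T x))) (vadd y (rs l (app T y)))) by vec.
    rewrite e. vec.
Qed.

(** The range of [1 + l T] is dense, since a vector [z] orthogonal to it satisfies [T z = - z / l],
    against positivity unless [z = 0]. It is closed by [psa_resolvent_bound] and the closedness of
    [T]. *)
Lemma psa_resolvent l h : 0 < l -> exists x, dom T x /\ vadd x (rs l (app T x)) = h.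
Proof.
  intro hl. assert (hT' := hT).
  destruct hT' as [[d0 [da ds]] [_ [aa [ar [_ [_ [sym [adj pos]]]]]]]].
  destruct (subspace_dense (fun w => exists x, dom T x /\ w = vadd x (rs l (app T x)))) with (x := h)
    as [w [hw cw]].
  - split; [|split].
    + exists vzero. split; [auto|]. rewrite psa_app_0. vec.
    + intros _ _ [x [hx ->]] [y [hy ->]]. exists (vadd x y). split; [auto|].
      rewrite aa by auto. vec.
    + intros r _ [x [hx ->]]. exists (rs r x). split; [auto|]. rewrite ar by auto. vec.
  - intros z hz. destruct (psa_adj z (rs (- / l) z)) as [dz ez].
    { intros x hx. assert (e := hz _ (ex_intro _ x (conj hx eq_refl))).
      revert e. vexp. rewrite (ip_sym z x), (ip_sym z). intro e.
      apply Rmult_eq_reg_l with l; [|lra].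
      replace (l * (- / l * ip x z)) with (- ip x z) by (field; lra). lra. }
    apply nsq_eq0. assert (e := pos z dz). rewrite ez, ip_rs_l in e. fold (nsq z) in e.
    assert (e1 := nsq_ge0 z). assert (e2 : 0 < / l) by (apply Rinv_0_lt_compat, hl). nra.
  - destruct (fun_choice _ _ _ hw) as [u hu].
    assert (cu : cauchy u).
    { apply cauchy_of_nsq_le with w (fun _ => vzero); [|eapply cvg_cauchy; eassumption|
        eapply cvg_cauchy, cvg_const].
      intros n m. destruct (hu n) as [h1 ->]. destruct (hu m) as [h2 ->].
      replace (vsub (vadd (u n) (rs l (app T (u n)))) (vadd (u m) (rs l (app T (u m)))))
        with (vadd (vsub (u n) (u m)) (rs l (app T (vsub (u n) (u m))))).
      - assert (e := psa_resolvent_bound l _ ltac:(lra) (psa_sub _ _ h1 h2)).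
        assert (e1 := nsq_ge0 (app T (vsub (u n) (u m)))).
        assert (e2 := nsq_ge0 (vsub vzero (vzero : H))). nra.
      - rewrite psa_app_sub by auto. vec. }
    destruct (cauchy_cvg u cu) as [x hx].
    destruct (psa_closed u x (rs (/ l) (vsub h x))) as [dx ex]; [apply hu|exact hx| |].
    { assert (c : cvg (fun n => rs (/ l) (vsub (w n) (u n))) (rs (/ l) (vsub h x))).
      { apply cvg_lipschitz with (K := / l) (G := rs (/ l)); [|exact (cvg_sub _ _ _ _ cw hx)].
        intros a b. replace (vsub (rs (/ l) a) (rs (/ l) b)) with (rs (/ l) (vsub a b)) by vec.
        rewrite norm_rs, Rabs_pos_eq; [lra|]. left. apply Rinv_0_lt_compat, hl. }
      intros eps he. destruct (c eps he) as [N hN]. exists N. intros n hn.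
      replace (app T (u n)) with (rs (/ l) (vsub (w n) (u n))); [auto|].
      destruct (hu n) as [_ ->]. vec. }
    exists x. split; [exact dx|]. rewrite ex. vec.
Qed.

(** Approximate [a] by some [b] in [dom T]; contractivity of [(1 + l T)^-1] bounds the distance of
    [y n] to [b] by [norm (a - b) + l * norm (T b)]. *)
Lemma psa_resolvent_cvg a (y : nat -> H) : (forall n, dom T (y n)) ->
  (forall n, vadd (y n) (rs (/ INR (S n)) (app T (y n))) = a) -> cvg y a.
Proof.
  intros dy ey eps he. assert (hT' := hT).
  destruct hT' as [_ [_ [_ [_ [_ [dd _]]]]]].
  destruct (dd a) as [v [hv cv]]. destruct (cv (eps / 4)) as [N0 hN0]; [lra|].
  assert (h1 := hN0 N0 (le_n _)). set (b := v N0) in *.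
  assert (db : dom T b) by apply hv.
  destruct (inv_S_lt (eps / (4 * (norm (app T b) + 1)))) as [N hN].
  { apply Rdiv_lt_0_compat; [lra|]. assert (e := norm_ge0 (app T b)). lra. }
  exists N. intros n hn. assert (e := hN n hn). assert (p := inv_S_pos n).
  set (l := / INR (S n)) in *.
  assert (q : norm (vsub (y n) b) <= norm (vsub a b) + l * norm (app T b)).
  { apply Rle_trans with (norm (vadd (vsub (y n) b) (rs l (app T (vsub (y n) b))))).
    - apply norm_le_nsq. assert (e1 := psa_resolvent_bound l _ ltac:(lra) (psa_sub _ _ (dy n) db)).
      assert (e2 := nsq_ge0 (app T (vsub (y n) b))). nra.
    - rewrite psa_app_sub by auto. rewrite <- (ey n).
      replace (vadd (vsub (y n) b) (rs l (vsub (app T (y n)) (app T b))))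
        with (vsub (vsub (vadd (y n) (rs l (app T (y n)))) b) (rs l (app T b))) by vec.
      apply Rle_trans with (1 := norm_sub _ _). rewrite (norm_rs l (app T b)), (Rabs_pos_eq l) by lra.
      fold l. lra. }
  assert (r : l * norm (app T b) < eps / 4).
  { assert (e1 := norm_ge0 (app T b)).
    apply Rle_lt_trans with (l * (norm (app T b) + 1)); [nra|].
    replace (eps / 4) with (eps / (4 * (norm (app T b) + 1)) * (norm (app T b) + 1)) by (field; lra).
    apply Rmult_lt_compat_r; lra. }
  assert (t := norm_tri (y n) b a). rewrite (norm_sub_sym a b) in q. lra.
Qed.

End Psa.

(** * The bounded operator [(1 + T)^-1] *)

(** [Z] is specified as a right inverse of [1 + T]; [resolvent_at_1_inv] shows that it is a left
    inverse too. *)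
Definition resolvent_at_1 (T : operator H) (Z : H -> H) : Prop :=
  forall h, dom T (Z h) /\ vadd (Z h) (app T (Z h)) = h.

Lemma resolvent_at_1_exists T : psa T -> exists Z, resolvent_at_1 T Z.
Proof.
  intro hT. apply (fun_choice H H (fun h x => dom T x /\ vadd x (app T x) = h)). intro h.
  destruct (psa_resolvent T hT 1 h) as [x [d e]]; [lra|]. rewrite rs_1 in e. eauto.
Qed.

Lemma resolvent_at_1_inv T Z x : psa T -> resolvent_at_1 T Z -> dom T x ->
  Z (vadd x (app T x)) = x.
Proof.
  intros hT hZ hx. destruct (hZ (vadd x (app T x))) as [d e].
  apply (psa_resolvent_inj T hT 1); [lra|auto|auto|]. rewrite !rs_1. exact e.
Qed.

Lemma resolvent_at_1_lin T Z : psa T -> resolvent_at_1 T Z -> lin Z.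
Proof.
  intros hT hZ. assert (hT' := hT). destruct hT' as [[d0 [da ds]] [dv [aa [ar [av _]]]]].
  assert (u : forall x h, dom T x -> vadd x (app T x) = h -> Z h = x).
  { intros x h hx <-. apply resolvent_at_1_inv; auto. }
  repeat split; intros; apply u.
  - apply da; apply hZ.
  - destruct (hZ x) as [d1 e1]. destruct (hZ y) as [d2 e2]. rewrite aa by auto.
    transitivity (vadd (vadd (Z x) (app T (Z x))) (vadd (Z y) (app T (Z y)))); [vec|].
    rewrite e1, e2. reflexivity.
  - apply ds, hZ.
  - destruct (hZ x) as [d1 e1]. rewrite ar by auto.
    transitivity (rs r (vadd (Z x) (app T (Z x)))); [vec|]. rewrite e1. reflexivity.
  - apply dv, hZ.
  - destruct (hZ x) as [d1 e1]. rewrite av by auto. rewrite <- vi_add, e1. reflexivity.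
Qed.

Lemma resolvent_at_1_inj T Z h : psa T -> resolvent_at_1 T Z -> Z h = vzero -> h = vzero.
Proof.
  intros hT hZ e. destruct (hZ h) as [d <-]. rewrite e, (psa_app_0 T hT). apply vadd_0.
Qed.

Lemma resolvent_at_1_sym T Z h k : psa T -> resolvent_at_1 T Z -> ip (Z h) k = ip h (Z k).
Proof.
  intros hT hZ. destruct (hZ h) as [d1 e1]. destruct (hZ k) as [d2 e2].
  transitivity (ip (Z h) (vadd (Z k) (app T (Z k)))); [rewrite e2; reflexivity|].
  transitivity (ip (vadd (Z h) (app T (Z h))) (Z k)); [|rewrite e1; reflexivity].
  rewrite ip_add_l, ip_add_r.
  destruct hT as [_ [_ [_ [_ [_ [_ [sym _]]]]]]]. rewrite sym by auto. reflexivity.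
Qed.

(** Pair [Z h] with [h = Z h + T (Z h)] and drop the non-negative term. [inverse_sub_1] goes back
    from this inequality to an operator. *)
Lemma resolvent_at_1_ge T Z h : psa T -> resolvent_at_1 T Z -> nsq (Z h) <= ip (Z h) h.
Proof.
  intros hT hZ. destruct (hZ h) as [d1 e1].
  apply Rle_trans with (ip (Z h) (vadd (Z h) (app T (Z h)))); [|rewrite e1; lra].
  rewrite ip_add_r, (ip_sym (Z h) (app T _)). fold (nsq (Z h)).
  destruct hT as [_ [_ [_ [_ [_ [_ [_ [_ pos]]]]]]]]. assert (e := pos _ d1). lra.
Qed.

Lemma resolvent_at_1_contract T Z h : psa T -> resolvent_at_1 T Z -> norm (Z h) <= norm h.
Proof.
  intros hT hZ. assert (e := resolvent_at_1_ge T Z h hT hZ).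
  assert (e1 := nsq_ge0 (vsub h (Z h))). rewrite nsq_sub, (ip_sym h) in e1.
  apply norm_le_nsq. lra.
Qed.

(** * Square roots and form domains *)

Definition psqrt (S T : operator H) : Prop :=
  psa T /\ psa S /\ (forall x, dom T x <-> dom S x /\ dom S (app S x)) /\
  (forall x, dom T x -> app S (app S x) = app T x).

Lemma psqrt_of_is_sqrt S T : nonneg_self_adjoint T -> is_sqrt S T -> psqrt S T.
Proof.
  intros hT [hS h]. split; [apply psa_iff, hT|]. split; [apply psa_iff, hS|exact h].
Qed.

(** The squared graph norm of [S], that is, the form norm of [S^2 + 1]. *)
Definition gsq (S : operator H) x : R := nsq x + nsq (app S x).

Lemma gsq_ge0 S x : 0 <= gsq S x.
Proof. unfold gsq. assert (e1 := nsq_ge0 x). assert (e2 := nsq_ge0 (app S x)). lra. Qed.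

Lemma psqrt_green S T x y : psqrt S T -> dom S x -> dom T y ->
  ip x y + ip (app S x) (app S y) = ip x (vadd y (app T y)).
Proof.
  intros [_ [hS [hd he]]] hx hy. rewrite ip_add_r, <- he by exact hy.
  apply hd in hy. destruct hS as [_ [_ [_ [_ [_ [_ [sym _]]]]]]]. rewrite sym by apply hy || auto.
  reflexivity.
Qed.

(** [Z h] is the Riesz representative of pairing with [h] in the graph inner product of [S]; this is
    how a form domain is read off from the resolvent. *)
Lemma psqrt_green_resolvent S T Z x h : psqrt S T -> resolvent_at_1 T Z -> dom S x ->
  ip x (Z h) + ip (app S x) (app S (Z h)) = ip x h.
Proof.
  intros hS hZ hx. destruct (hZ h) as [d e].
  rewrite (psqrt_green S T) by auto. rewrite e. reflexivity.
Qed.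

Lemma psqrt_resolvent_dom S T Z h : psqrt S T -> resolvent_at_1 T Z -> dom S (Z h).
Proof. intros [_ [_ [hd _]]] hZ. apply hd, hZ. Qed.

Lemma psqrt_gsq_resolvent S T Z h : psqrt S T -> resolvent_at_1 T Z ->
  gsq S (Z h) = ip (Z h) h.
Proof.
  intros hS hZ. apply (psqrt_green_resolvent S T); auto.
  apply psqrt_resolvent_dom with T; auto.
Qed.

Lemma psa_resolvent_seq T x : psa T -> exists y : nat -> H, forall n,
  dom T (y n) /\ vadd (y n) (rs (/ INR (S n)) (app T (y n))) = x.
Proof.
  intro hT. apply (fun_choice nat H (fun n y => dom T y /\ vadd y (rs (/ INR (S n)) (app T y)) = x)).
  intro n. apply psa_resolvent; [exact hT|apply inv_S_pos].
Qed.

(* [S] commutes with the resolvents of [T]. *)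
Lemma psqrt_resolvent_seq_cvg S T x (y : nat -> H) : psqrt S T -> dom S x ->
  (forall n, dom T (y n) /\ vadd (y n) (rs (/ INR (Datatypes.S n)) (app T (y n))) = x) ->
  cvg y x /\ cvg (fun n => app S (y n)) (app S x).
Proof.
  intros [hT [hS [hd he]]] hx hy. split.
  - apply (psa_resolvent_cvg T hT); apply hy.
  - assert (hS' := hS). destruct hS' as [[_ [_ ds]] [_ [aa [ar _]]]].
    (* [T (y n)] is a multiple of [x - y n], hence in [dom S]. So [S (y n)] is in [dom T] and equals
       [(1 + l T)^-1 (S x)], and the convergence of resolvents applies to [S x]. *)
    assert (d : forall n, dom S (app T (y n))).
    { intro n. destruct (hy n) as [d e]. set (l := / INR (Datatypes.S n)) in *.
      assert (p : 0 < l) by apply inv_S_pos.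
      replace (app T (y n)) with (rs (/ l) (vsub x (y n))).
      - apply ds, (psa_sub S hS); [exact hx|apply hd, d].
      - rewrite <- e. vec. }
    assert (dS : forall n, dom S (y n) /\ dom S (app S (y n))) by (intro n; apply hd, hy).
    assert (dT : forall n, dom T (app S (y n))).
    { intro n. apply hd. split; [apply dS|]. rewrite he by apply hy. apply d. }
    apply (psa_resolvent_cvg T hT); [exact dT|]. intro n.
    rewrite <- (he (app S (y n)) (dT n)), (he (y n)) by apply hy.
    rewrite <- ar, <- aa by first [apply d | apply dS | apply ds, d].
    f_equal. apply hy.
Qed.

Lemma psqrt_core S T x : psqrt S T -> dom S x ->
  exists y : nat -> H, (forall n, dom T (y n)) /\ cvg y x /\
    cvg (fun n => app S (y n)) (app S x).
Proof.
  intros hS hx. destruct (psa_resolvent_seq T x (proj1 hS)) as [y hy].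
  exists y. split; [apply hy|]. apply psqrt_resolvent_seq_cvg with T; auto.
Qed.

(* [a] is recovered from [y n = (1 + T / n)^-1 a], whose graph norm is bounded
   because [a] has finite [S1] graph norm and the resolvents are ordered. *)
Lemma psqrt_dom_incl S T Z S1 T1 A a : psqrt S T -> resolvent_at_1 T Z ->
  psqrt S1 T1 -> resolvent_at_1 T1 A -> (forall h, ip (A h) h <= ip (Z h) h) ->
  dom S1 a -> dom S a /\ gsq S a <= gsq S1 a.
Proof.
  intros hS hZ hS1 hA hAZ ha. assert (hS' := hS). destruct hS' as [hT [hS0 [hd he]]].
  destruct (psa_resolvent_seq T a hT) as [y hy].
  assert (cy : cvg y a) by (apply (psa_resolvent_cvg T hT); apply hy).
  assert (b : forall n, gsq S (y n) <= gsq S1 a).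
  { intro n. destruct (hy n) as [d e]. set (l := / INR (Datatypes.S n)) in *.
    assert (p : 0 < l) by apply inv_S_pos.
    set (h := vadd (y n) (app T (y n))).
    assert (eZ : Z h = y n) by (apply resolvent_at_1_inv; auto).
    assert (e1 : gsq S (y n) = ip (y n) h) by (rewrite <- eZ; apply psqrt_gsq_resolvent with T; auto).
    assert (e2 := psqrt_green_resolvent S1 T1 A a h hS1 hA ha).
    assert (e3 := psqrt_gsq_resolvent S1 T1 A h hS1 hA).
    assert (e4 := hAZ h). rewrite eZ in e4.
    (* [a - y n = l T (y n)], whose pairing with [h = y n + T (y n)] is non-negative. *)
    assert (e5 : ip (y n) h <= ip a h).
    { apply Rle_trans with (ip (vadd (y n) (rs l (app T (y n)))) h); [|rewrite e; lra].
      rewrite ip_add_l, ip_rs_l. unfold h at 3. rewrite ip_add_r.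
      assert (e5 := nsq_ge0 (app T (y n))). unfold nsq in e5.
      assert (hT' := hT). destruct hT' as [_ [_ [_ [_ [_ [_ [_ [_ pos]]]]]]]].
      assert (e6 := pos _ d).
      assert (e7 : 0 <= l * (ip (app T (y n)) (y n) + ip (app T (y n)) (app T (y n))))
        by (apply Rmult_le_pos; lra).
      lra. }
    (* Expanding [gsq S1 (a - A h) >= 0] gives [gsq S1 a >= 2 (a, h) - (A h, h)], and the right side
       is at least [2 (y n, h) - (Z h, h) = gsq S (y n)]. *)
    assert (f1 := nsq_ge0 (vsub a (A h))).
    assert (f2 := nsq_ge0 (vsub (app S1 a) (app S1 (A h)))).
    rewrite nsq_sub in f1, f2. unfold gsq in *. lra. }
  assert (da : dom S a).
  { apply (psa_dom_of_bounded S hS0 y a (sqrt (gsq S1 a))); [|exact cy|].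
    - intro n. apply hd, hy.
    - intro n. apply sqrt_le_1_alt. change (nsq (app S (y n)) <= gsq S1 a).
      assert (e := b n). assert (e1 := nsq_ge0 (y n)). unfold gsq in *. lra. }
  split; [exact da|].
  destruct (psqrt_resolvent_seq_cvg S T a y hS da hy) as [_ cSy].
  eapply Un_cv_le; [exact b| |apply Un_cv_const].
  apply CV_plus; apply cvg_ip; assumption.
Qed.

(** * Form domains of operators whose resolvents add up *)

Section Sum.
Variables (S S1 S2 T T1 T2 : operator H) (Z A C : H -> H).
Hypotheses (hS : psqrt S T) (hS1 : psqrt S1 T1) (hS2 : psqrt S2 T2).
Hypotheses (hZ : resolvent_at_1 T Z) (hA : resolvent_at_1 T1 A) (hC : resolvent_at_1 T2 C).
Hypothesis Z_sum : forall h, Z h = vadd (A h) (C h).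
Hypothesis disjoint : forall x, dom S1 x -> dom S2 x -> x = vzero.

(** [C >= 0] yields [A <= Z], so the comparison of form domains applies. *)
Lemma sum_dom_incl_l a : dom S1 a -> dom S a /\ gsq S a <= gsq S1 a.
Proof.
  apply (psqrt_dom_incl S T Z S1 T1 A); auto. intro h. rewrite Z_sum, ip_add_l.
  assert (e := resolvent_at_1_ge T2 C h (proj1 hS2) hC). assert (e1 := nsq_ge0 (C h)). lra.
Qed.

Lemma sum_dom_incl_r a : dom S2 a -> dom S a /\ gsq S a <= gsq S2 a.
Proof.
  apply (psqrt_dom_incl S T Z S2 T2 C); auto. intro h. rewrite Z_sum, ip_add_l.
  assert (e := resolvent_at_1_ge T1 A h (proj1 hS1) hA). assert (e1 := nsq_ge0 (A h)). lra.
Qed.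

(* On [ran Z] the decomposition is [Z h = A h + C h]; it extends by continuity. *)
Lemma sum_decompose x : dom S x -> exists a b, dom S1 a /\ dom S2 b /\
  x = vadd a b /\ gsq S x = gsq S1 a + gsq S2 b.
Proof.
  intro hx. destruct (psqrt_core S T x hS hx) as [y [dy [cy cSy]]].
  assert (hS' := hS). destruct hS' as [hT [pS _]].
  assert (hS1' := hS1). destruct hS1' as [hT1 [pS1 _]].
  assert (hS2' := hS2). destruct hS2' as [hT2 [pS2 _]].
  assert (lA := resolvent_at_1_lin T1 A hT1 hA). assert (lC := resolvent_at_1_lin T2 C hT2 hC).
  assert (lZ := resolvent_at_1_lin T Z hT hZ).
  (* [h n] need not converge; only its images under [A], [C], [S1 A] and [S2 C] are shown to. *)
  set (h := fun n => vadd (y n) (app T (y n))).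
  assert (eZ : forall n, Z (h n) = y n) by (intro n; apply resolvent_at_1_inv; auto).
  assert (dA : forall g, dom S1 (A g)) by (intro g; apply psqrt_resolvent_dom with T1; auto).
  assert (dC : forall g, dom S2 (C g)) by (intro g; apply psqrt_resolvent_dom with T2; auto).
  assert (dZ : forall g, dom S (Z g)) by (intro g; apply psqrt_resolvent_dom with T; auto).
  (* Both sides are [(Z g, g)]; this is the isometry that transfers Cauchy sequences. *)
  assert (split : forall g, gsq S (Z g) = gsq S1 (A g) + gsq S2 (C g)).
  { intro g. rewrite (psqrt_gsq_resolvent S T), (psqrt_gsq_resolvent S1 T1),
      (psqrt_gsq_resolvent S2 T2), Z_sum by assumption. apply ip_add_l. }
  assert (bound : forall n m,
    gsq S1 (A (vsub (h n) (h m))) + gsq S2 (C (vsub (h n) (h m))) <=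
    nsq (vsub (y n) (y m)) + nsq (vsub (app S (y n)) (app S (y m)))).
  { intros n m. rewrite <- split. unfold gsq.
    rewrite lin_sub, (psa_app_sub S pS), !eZ by auto. lra. }
  assert (cau : forall w : nat -> H, (forall n m, nsq (vsub (w n) (w m)) <=
      gsq S1 (A (vsub (h n) (h m))) + gsq S2 (C (vsub (h n) (h m)))) -> exists l, cvg w l).
  { intros w hw. apply cauchy_cvg.
    apply cauchy_of_nsq_le with y (fun n => app S (y n)); [|eapply cvg_cauchy; eassumption..].
    intros n m. apply Rle_trans with (1 := hw n m), bound. }
  destruct (cau (fun n => A (h n))) as [a ca].
  { intros n m. rewrite <- lin_sub by auto. assert (e := gsq_ge0 S2 (C (vsub (h n) (h m)))).
    unfold gsq at 1. assert (e1 := nsq_ge0 (app S1 (A (vsub (h n) (h m))))). lra. }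
  destruct (cau (fun n => app S1 (A (h n)))) as [a' ca'].
  { intros n m. rewrite <- (psa_app_sub S1 pS1), <- lin_sub by auto.
    assert (e := gsq_ge0 S2 (C (vsub (h n) (h m)))).
    unfold gsq at 1. assert (e1 := nsq_ge0 (A (vsub (h n) (h m)))). lra. }
  destruct (cau (fun n => C (h n))) as [b cb].
  { intros n m. rewrite <- lin_sub by auto. assert (e := gsq_ge0 S1 (A (vsub (h n) (h m)))).
    unfold gsq at 2. assert (e1 := nsq_ge0 (app S2 (C (vsub (h n) (h m))))). lra. }
  destruct (cau (fun n => app S2 (C (h n)))) as [b' cb'].
  { intros n m. rewrite <- (psa_app_sub S2 pS2), <- lin_sub by auto.
    assert (e := gsq_ge0 S1 (A (vsub (h n) (h m)))).
    unfold gsq at 2. assert (e1 := nsq_ge0 (C (vsub (h n) (h m)))). lra. }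
  destruct (psa_closed S1 pS1 _ _ _ (fun n => dA (h n)) ca ca') as [da ea].
  destruct (psa_closed S2 pS2 _ _ _ (fun n => dC (h n)) cb cb') as [db eb].
  exists a, b. split; [exact da|]. split; [exact db|]. split.
  - apply cvg_unique with (1 := cy). intros eps he.
    destruct (cvg_add _ _ _ _ ca cb eps he) as [N hN]. exists N. intros n hn.
    rewrite <- eZ, Z_sum. apply hN, hn.
  - unfold gsq. rewrite ea, eb. eapply Un_cv_eq;
      [|apply CV_plus; apply cvg_ip; [exact cy|exact cy|exact cSy|exact cSy]
       |apply CV_plus; apply CV_plus; apply cvg_ip; eassumption].
    intro n. assert (e := split (h n)). rewrite eZ in e. exact e.
Qed.

(** Decompose [a] itself: its second component is a difference of elements of [dom S1], so it lies
    in both form domains and vanishes. *)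
Lemma sum_gsq_l a : dom S1 a -> gsq S1 a = gsq S a.
Proof.
  intro ha. destruct (sum_dom_incl_l a ha) as [da _].
  destruct (sum_decompose a da) as [a' [b [ha' [hb [e1 e2]]]]].
  assert (b0 : b = vzero).
  { apply disjoint; [|exact hb]. replace b with (vsub a a') by (rewrite e1; vec).
    apply (psa_sub S1); auto. apply hS1. }
  subst b. rewrite e2. replace a' with a by (rewrite e1; vec).
  unfold gsq. rewrite (psa_app_0 S2) by apply hS2. unfold nsq. rewrite ip_0_l. ring.
Qed.

Lemma sum_gsq_add a b : dom S1 a -> dom S2 b -> gsq S (vadd a b) = gsq S1 a + gsq S2 b.
Proof.
  intros ha hb. destruct (sum_dom_incl_l a ha) as [da _]. destruct (sum_dom_incl_r b hb) as [db _].
  destruct (sum_decompose (vadd a b)) as [a' [b' [ha' [hb' [e1 e2]]]]].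
  { apply (psa_dom_add S); auto. apply hS. }
  assert (e3 : vsub a a' = vsub b' b).
  { transitivity (vsub (vsub (vadd a b) b) a'); [vec|]. rewrite e1. vec. }
  assert (e4 : vsub a a' = vzero).
  { apply disjoint; [apply (psa_sub S1); auto; apply hS1|].
    rewrite e3. apply (psa_sub S2); auto; apply hS2. }
  rewrite e2, (vsub_eq0 _ _ e4). rewrite e3 in e4. rewrite (vsub_eq0 _ _ e4). reflexivity.
Qed.

Lemma sum_gsq_r b : dom S2 b -> gsq S2 b = gsq S b.
Proof.
  intro hb. assert (d0 : dom S1 vzero) by (apply (psa_dom_0 S1); apply hS1).
  assert (e := sum_gsq_add vzero b d0 hb). replace (vadd vzero b) with b in e by vec.
  rewrite e. unfold gsq at 2. rewrite (psa_app_0 S1) by apply hS1. unfold nsq.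
  rewrite ip_0_l. ring.
Qed.

(** Additivity of [gsq] on [a + b] kills the real cross term; [vi a] in place of [a] gives the
    imaginary part. *)
Lemma sum_ortho a b : dom S1 a -> dom S2 b ->
  Cadd (inner (app S a) (app S b)) (inner a b) = C0.
Proof.
  assert (re : forall a b, dom S1 a -> dom S2 b -> ip (app S a) (app S b) + ip a b = 0).
  { intros x y hx hy. assert (e := sum_gsq_add x y hx hy).
    rewrite (sum_gsq_l x hx), (sum_gsq_r y hy) in e.
    destruct (sum_dom_incl_l x hx) as [dx _]. destruct (sum_dom_incl_r y hy) as [dy _].
    assert (aS : app S (vadd x y) = vadd (app S x) (app S y)) by (apply (psa_app_add S); auto; apply hS).
    unfold gsq in e. rewrite aS, !nsq_add in e. lra. }
  intros ha hb. apply C_ext; [apply re; auto|]. simpl. rewrite !Im_inner.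
  destruct (sum_dom_incl_l a ha) as [da _].
  assert (aS : app S (vi a) = vi (app S a)) by (apply (psa_app_vi S); auto; apply hS).
  rewrite <- aS. assert (e := re (vi a) b (psa_dom_vi S1 (proj1 (proj2 hS1)) a ha) hb). lra.
Qed.

(** If [A h + C h] lies in one form domain, the summand from the other lies in both and vanishes,
    and the resolvents are injective. As [dom T] is the range of [Z], this is claim (1). *)
Lemma sum_resolvent_ortho h : dom S1 (Z h) \/ dom S2 (Z h) -> h = vzero.
Proof.
  assert (dA : dom S1 (A h)) by (apply psqrt_resolvent_dom with T1; auto).
  assert (dC : dom S2 (C h)) by (apply psqrt_resolvent_dom with T2; auto).
  rewrite Z_sum. intros [d|d].
  - apply (resolvent_at_1_inj T2 C); [apply hS2|exact hC|]. apply disjoint; [|exact dC].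
    replace (C h) with (vsub (vadd (A h) (C h)) (A h)) by vec. apply (psa_sub S1); auto. apply hS1.
  - apply (resolvent_at_1_inj T1 A); [apply hS1|exact hA|]. apply disjoint; [exact dA|].
    replace (A h) with (vsub (vadd (A h) (C h)) (C h)) by vec. apply (psa_sub S2); auto. apply hS2.
Qed.

End Sum.

(* [Z^-1 - 1] *)
Lemma inverse_sub_1 (Z : H -> H) : lin Z -> (forall x y, ip (Z x) y = ip x (Z y)) ->
  (forall x, Z x = vzero -> x = vzero) -> (forall x, nsq (Z x) <= ip (Z x) x) ->
  exists T, psa T /\ resolvent_at_1 T Z.
Proof.
  intros lZ sZ iZ bZ.
  assert (inj : forall x y, Z x = Z y -> x = y).
  { intros x y e. apply vsub_eq0, iZ. rewrite lin_sub, e by exact lZ. vec. }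
  (* [W] inverts [Z] on its range; off the range its value is arbitrary. *)
  destruct (fun_choice H H (fun x h => (exists k, x = Z k) -> x = Z h)) as [W hW].
  { intro x. destruct (classic (exists k, x = Z k)) as [[k e]|n]; [exists k; auto|].
    exists x. intro. contradiction. }
  assert (WZ : forall h, W (Z h) = h).
  { intro h. apply inj. symmetry. apply hW. eauto. }
  exists {| dom := fun x => exists k, x = Z k; app := fun x => vsub (W x) x |}.
  assert (lZ' := lZ). destruct lZ' as [la [lr lv]].
  assert (sub : subspace (fun x => exists k, x = Z k)).
  { split; [|split].
    - exists vzero. symmetry. apply lin_0, lZ.
    - intros _ _ [k ->] [m ->]. exists (vadd k m). symmetry. apply la.
    - intros r _ [k ->]. exists (rs r k). symmetry. apply lr. }
  split; [unfold psa; simpl; repeat match goal with |- _ /\ _ => split end|].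
  - exact sub.
  - intros _ [k ->]. exists (vi k). symmetry. apply lv.
  - intros _ _ [k ->] [m ->]. rewrite <- la, !WZ, la. vec.
  - intros r _ [k ->]. rewrite <- lr, !WZ, lr. vec.
  - intros _ [k ->]. rewrite <- lv, !WZ, lv. vec.
  - apply (subspace_dense (fun x => exists k, x = Z k)); [exact sub|]. intros z hz. apply iZ, nsq_eq0.
    unfold nsq. rewrite sZ. apply hz. eauto.
  - intros _ _ [k ->] [m ->]. rewrite !WZ, ip_sub_l, ip_sub_r, (sZ k m). ring.
  (* The relation at [x = Z k] reads [(k - Z k, y) = (Z k, z)], that is,
     [(k, y) = (k, Z (y + z))]. *)
  - intros y z h. exists (vadd y z). apply ip_ext. intro k.
    assert (e := h (Z k) (ex_intro _ k eq_refl)). rewrite WZ in e.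
    rewrite sZ, ip_add_l, (ip_sym z), <- e, ip_sub_l, (ip_sym y (Z k)), (ip_sym y k). ring.
  - intros _ [k ->]. rewrite WZ, ip_sub_l, (ip_sym k). assert (e := bZ k). unfold nsq in e. lra.
  - intro h. simpl. split; [eauto|]. rewrite WZ. vec.
Qed.

(** * An operator whose adjoint has range disjoint from a given operator range *)

(** The bound is asked for at arbitrarily large [n] only, because it will be available just along
    the indices where [recur] takes a given value. *)
Lemma le_pow_0 (a c q : R) : 0 < q < 1 ->
  (forall n0, exists n, (n0 <= n)%nat /\ a <= c * q ^ n) -> a <= 0.
Proof.
  intros hq h. destruct (Rle_lt_dec a 0) as [l|l]; [exact l|exfalso].
  assert (hc : 0 < Rabs c + 1) by (assert (e := Rabs_pos c); lra).
  destruct (pow_lt_1_zero q ltac:(rewrite Rabs_pos_eq; lra) (a / (Rabs c + 1))) as [N hN].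
  { apply Rdiv_lt_0_compat; lra. }
  destruct (h N) as [n [hn e]]. assert (e1 := hN n hn).
  assert (p : 0 < q ^ n) by (apply pow_lt; lra). rewrite Rabs_pos_eq in e1 by lra.
  assert (e2 := Rle_abs c).
  assert (e3 : q ^ n * (Rabs c + 1) < a).
  { apply Rlt_le_trans with (a / (Rabs c + 1) * (Rabs c + 1)); [|right; field; lra].
    apply Rmult_lt_compat_r; lra. }
  assert (c * q ^ n <= (Rabs c + 1) * q ^ n) by (apply Rmult_le_compat_r; lra). lra.
Qed.

(** * Geometrically convergent series of operators *)

Fixpoint psum (F : nat -> H -> H) x (n : nat) : H :=
  match n with
  | O => vzero
  | S m => vadd (psum F x m) (F m x)
  end.

Lemma psum_ip_0 (F : nat -> H -> H) x y n : (forall j, (j < n)%nat -> ip (F j x) y = 0) ->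
  ip (psum F x n) y = 0.
Proof.
  induction n as [|n IH]; intro h; simpl; [apply ip_0_l|].
  rewrite ip_add_l, IH, h by auto. ring.
Qed.

Lemma psum_ip_1 (F : nat -> H -> H) x y n N : (n < N)%nat ->
  (forall j, j <> n -> ip (F j x) y = 0) -> ip (psum F x N) y = ip (F n x) y.
Proof.
  intros hn h. induction N as [|N IH]; [lia|]. simpl. rewrite ip_add_l.
  destruct (Nat.eq_dec n N) as [->|ne].
  - rewrite psum_ip_0; [ring|]. intros j hj. apply h. lia.
  - rewrite IH, (h N) by lia. ring.
Qed.

Lemma psum_lin (F : nat -> H -> H) n : (forall j, lin (F j)) -> lin (fun x => psum F x n).
Proof.
  intro h. induction n as [|n [i1 [i2 i3]]]; simpl.
  - repeat split; intros; vec.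
  - destruct (h n) as [a [r v]]. repeat split; intros.
    + rewrite i1, a. vec.
    + rewrite i2, r. vec.
    + rewrite i3, v. vec.
Qed.

(** [G] is the sum of the [F j]; the factor 2 bounds [1 / (1 - q)] for [q <= 1 / 2]. *)
Definition series_tail (F : nat -> H -> H) (q : R) (G : H -> H) : Prop :=
  forall n x, norm (vsub (G x) (psum F x n)) <= 2 * q ^ n * norm x.

Lemma series_exists (F : nat -> H -> H) q : 0 < q <= / 2 -> (forall j, lin (F j)) ->
  (forall j x, norm (F j x) <= q ^ j * norm x) ->
  exists G, lin G /\ series_tail F q G.
Proof.
  intros hq hF bF.
  (* The subtracted [q ^ (k + n)] makes the induction close: the step needs
     [q ^ j <= 2 (q ^ j - q ^ (j + 1))], where [q <= 1 / 2] enters. *)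
  assert (b : forall x n k, norm (vsub (psum F x (k + n)) (psum F x n)) <=
    2 * (q ^ n - q ^ (k + n)) * norm x).
  { intros x n k. induction k as [|k IH]; simpl.
    - replace (vsub (psum F x n) (psum F x n)) with (vzero : H) by vec. rewrite norm_0.
      right. ring.
    - replace (vsub (vadd (psum F x (k + n)) (F (k + n)%nat x)) (psum F x n))
        with (vadd (vsub (psum F x (k + n)) (psum F x n)) (F (k + n)%nat x)) by vec.
      apply Rle_trans with (1 := norm_add _ _). assert (e := bF (k + n)%nat x).
      assert (p : 0 <= q ^ (k + n)) by (apply pow_le; lra). assert (p' := norm_ge0 x).
      assert (0 <= q ^ (k + n) * norm x) by (apply Rmult_le_pos; lra). nra. }
  assert (b' : forall x n k, norm (vsub (psum F x (k + n)) (psum F x n)) <= 2 * q ^ n * norm x).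
  { intros x n k. apply Rle_trans with (1 := b x n k).
    assert (p : 0 <= q ^ (k + n)) by (apply pow_le; lra). assert (p' := norm_ge0 x).
    assert (0 <= q ^ (k + n) * norm x) by (apply Rmult_le_pos; lra). nra. }
  destruct (fun_choice H H (fun x g => cvg (psum F x) g)) as [G hG].
  { intro x. apply cauchy_cvg. intros eps he. apply NNPP. intro no.
    enough (eps <= 0) by lra. apply le_pow_0 with (c := 4 * norm x) (q := q); [lra|].
    intro n0. apply NNPP. intro no'. apply no. exists n0. intros n m hn hm.
    replace n with ((n - n0) + n0)%nat by lia. replace m with ((m - n0) + n0)%nat by lia.
    assert (e1 := b' x n0 (n - n0)%nat). assert (e2 := b' x n0 (m - n0)%nat).
    assert (t := norm_tri (psum F x (n - n0 + n0)) (psum F x n0) (psum F x (m - n0 + n0))).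
    rewrite norm_sub_sym in e2.
    destruct (Rlt_le_dec (4 * norm x * q ^ n0) eps) as [l|l]; [lra|].
    exfalso. apply no'. exists n0. auto. }
  exists G. split.
  - repeat split; intros.
    + apply cvg_unique with (1 := hG (vadd x y)). intros eps he.
      destruct (cvg_add _ _ _ _ (hG x) (hG y) eps he) as [N hN]. exists N. intros n hn.
      rewrite (proj1 (psum_lin F n hF)). auto.
    + apply cvg_unique with (1 := hG (rs r x)). intros eps he.
      assert (c : cvg (fun n => rs r (psum F x n)) (rs r (G x))).
      { apply cvg_lipschitz with (K := Rabs r) (G := rs r); [|apply hG]. intros y z.
        rewrite <- norm_rs. right. f_equal. vec. }
      destruct (c eps he) as [N hN]. exists N. intros n hn.
      rewrite (proj1 (proj2 (psum_lin F n hF))). auto.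
    + apply cvg_unique with (1 := hG (vi x)). intros eps he.
      assert (c : cvg (fun n => vi (psum F x n)) (vi (G x))).
      { apply cvg_lipschitz with (K := 1) (G := @vi); [|apply hG]. intros y z.
        rewrite <- vi_sub, norm_vi. lra. }
      destruct (c eps he) as [N hN]. exists N. intros n hn.
      rewrite (proj2 (proj2 (psum_lin F n hF))). auto.
  - intros n x. apply cvg_norm_le with (fun k => psum F x (k + n)); [|apply b'].
    intros eps he. destruct (hG x eps he) as [N hN]. exists N. intros k hk. apply hN. lia.
Qed.

Lemma series_bound (F : nat -> H -> H) q G x : series_tail F q G -> norm (G x) <= 2 * norm x.
Proof.
  intro h. assert (e := h 0%nat x). simpl in e.
  replace (vsub (G x) vzero) with (G x) in e by vec. lra.
Qed.

Lemma series_coord (F : nat -> H -> H) q G x y n : 0 < q < 1 -> series_tail F q G ->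
  (forall j, j <> n -> ip (F j x) y = 0) -> ip (G x) y = ip (F n x) y.
Proof.
  intros hq hG h. apply Rminus_diag_uniq. assert (e : Rabs (ip (G x) y - ip (F n x) y) <= 0).
  { apply le_pow_0 with (c := 2 * norm x * norm y) (q := q); [exact hq|].
    intro n0. exists (max n0 (S n)). split; [lia|].
    rewrite <- (psum_ip_1 F x y n (max n0 (S n))) by (lia || exact h).
    rewrite <- ip_sub_l. apply Rle_trans with (1 := cauchy_schwarz _ _).
    assert (e := hG (max n0 (S n)) x). assert (p := norm_ge0 y).
    assert (e1 := Rmult_le_compat_r _ _ _ p e). lra. }
  destruct (Req_dec (ip (G x) y - ip (F n x) y) 0) as [z|z]; [exact z|].
  apply Rabs_pos_lt in z. lra.
Qed.

(* [c * (h, e) * f] with the complex inner product. *)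
Definition rank1 (c : R) (e f h : H) : H :=
  rs c (vadd (rs (ip h e) f) (rs (ip h (vi e)) (vi f))).

Lemma rank1_lin c e f : lin (rank1 c e f).
Proof.
  unfold rank1. repeat split; intros.
  - rewrite !ip_add_l. vec.
  - rewrite !ip_rs_l. vec.
  - rewrite vi_vi_ip, ip_vi_l. vec.
Qed.

Lemma rank1_bound c e f h : 0 <= c -> norm e <= 1 -> norm f <= 1 ->
  norm (rank1 c e f h) <= c * norm h.
Proof.
  intros hc he hf. unfold rank1. rewrite norm_rs, Rabs_pos_eq by exact hc.
  apply Rmult_le_compat_l; [exact hc|].
  assert (q : forall (a b : R) g, nsq (vadd (rs a g) (rs b (vi g))) = (a * a + b * b) * nsq g).
  { intros a b g. rewrite nsq_add, !nsq_rs, nsq_vi, ip_rs_l, ip_rs_r, ip_vi_self. ring. }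
  apply norm_le_nsq. rewrite q. set (a := ip h e). set (b := ip h (vi e)).
  assert (e1 := nsq_le _ _ he). assert (e2 := nsq_le _ _ hf).
  (* Bessel for one vector: [h] pairs with this multiple of [e] to [m], and its squared norm is at
     most [m], so [m * m <= nsq h * m]. *)
  assert (cs := cauchy_schwarz_sq h (vadd (rs a e) (rs b (vi e)))).
  rewrite q, ip_add_r, !ip_rs_r in cs. fold a b in cs.
  assert (p1 := nsq_ge0 h). assert (p2 := nsq_ge0 e). assert (p3 := nsq_ge0 f).
  set (m := a * a + b * b) in *. assert (p4 : 0 <= m) by (unfold m; nra).
  assert (m * m <= nsq h * m).
  { apply Rle_trans with (1 := cs). rewrite <- (Rmult_1_r m) at 2.
    apply Rmult_le_compat_l; [exact p1|]. apply Rmult_le_compat_l; lra. }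
  assert (m <= nsq h).
  { destruct (Rle_lt_dec m (nsq h)) as [l|l]; [exact l|exfalso]. nra. }
  nra.
Qed.

Definition ortho x y : Prop := ip x y = 0 /\ ip x (vi y) = 0.

Lemma ortho_sym x y : ortho x y -> ortho y x.
Proof.
  intros [h1 h2]. split; rewrite ip_sym; [exact h1|]. rewrite ip_vi_l, h2. ring.
Qed.

(* Every value is taken infinitely often. *)
Definition recur (j : nat) : nat := (j - Nat.sqrt j * Nat.sqrt j)%nat.

Lemma recur_le j : (recur j <= j)%nat.
Proof. unfold recur. lia. Qed.

Lemma recur_io k n0 : exists j, (n0 <= j)%nat /\ recur j = k.
Proof.
  (* [k <= m] keeps [m * m + k] below the next square. *)
  set (m := (n0 + k)%nat). exists (m * m + k)%nat. split; [unfold m; nia|].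
  unfold recur. replace (Nat.sqrt (m * m + k)) with m; [lia|].
  symmetry. apply Nat.sqrt_unique. unfold m. nia.
Qed.

(** * Construction of the operator [P] from an orthonormal sequence on which [B] decays *)

Section Disjoint.
Variable B : H -> H.
Hypothesis B_lin : lin B.
Hypothesis B_sym : forall x y, ip (B x) y = ip x (B y).
Hypothesis B_bound : forall x, norm (B x) <= norm x.
Hypothesis B_inj : forall x, B x = vzero -> x = vzero.
(** The witnesses lie in the range of [B] so that the orthonormal vectors made from them do too, as
    [almost_ortho] requires. *)
Hypothesis B_small : forall d, 0 < d -> exists x, norm (B (B x)) < d * norm (B x).

Fixpoint orthonormal_in_range (l : list H) : Prop :=
  match l with
  | nil => True
  | cons f l' => nsq f = 1 /\ (exists k, f = B k) /\ (forall g, List.In g l' -> ortho f g) /\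
      orthonormal_in_range l'
  end.

(* For [f = B k] one has [(x, f) = (B x, k)], so the component of [x] along [f]
   is controlled by [B x]. *)
Lemma almost_ortho l : orthonormal_in_range l -> exists K, 0 <= K /\
  forall x, exists x', (forall f, List.In f l -> ortho x' f) /\
    norm (vsub x' x) <= K * norm (B x) /\ ((exists k, x = B k) -> exists k, x' = B k).
Proof.
  assert (lB := B_lin). destruct lB as [Ba [Br Bv]].
  induction l as [|f l IH]; simpl.
  - intros _. exists 0. split; [lra|]. intro x. exists x. split; [contradiction|]. split; [|auto].
    replace (vsub x x) with (vzero : H) by vec. rewrite norm_0. lra.
  - intros [f1 [[k hk] [of hl]]]. destruct (IH hl) as [K [hK h]].
    assert (pk := norm_ge0 k).
    (* [norm (B x')] is at most [(1 + K) * norm (B x)], and each of the two real coefficients along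
       [f] is at most [norm k] times that. *)
    exists (K + 2 * norm k * (1 + K)). split; [nra|]. intro x.
    destruct (h x) as [x' [o [b r]]].
    set (c := ip x' f). set (d := ip x' (vi f)).
    exists (vsub (vsub x' (rs c f)) (rs d (vi f))).
    assert (bB : norm (B x') <= (1 + K) * norm (B x)).
    { replace (B x') with (vadd (B x) (B (vsub x' x))) by (rewrite <- Ba; f_equal; vec).
      apply Rle_trans with (1 := norm_add _ _). assert (e := B_bound (vsub x' x)). lra. }
    assert (pf : norm f = 1).
    { unfold norm. change (sqrt (nsq f) = 1). rewrite f1. apply sqrt_1. }
    assert (bc : Rabs c <= norm k * ((1 + K) * norm (B x))).
    { unfold c. rewrite hk, <- B_sym. apply Rle_trans with (1 := cauchy_schwarz _ _).
      rewrite Rmult_comm. apply Rmult_le_compat_l; assumption. }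
    assert (bd : Rabs d <= norm k * ((1 + K) * norm (B x))).
    { unfold d. rewrite hk, <- Bv, <- B_sym. apply Rle_trans with (1 := cauchy_schwarz _ _).
      rewrite norm_vi, Rmult_comm. apply Rmult_le_compat_l; assumption. }
    split; [|split].
    + intros g [<-|hg].
      * unfold ortho. rewrite !ip_sub_l, !ip_rs_l, vi_vi_ip, ip_vi_self, ip_vi_l, ip_vi_self.
        fold (nsq f). rewrite f1. fold c d. split; ring.
      * destruct (o g hg) as [o1 o2]. destruct (of g hg) as [o3 o4].
        unfold ortho. rewrite !ip_sub_l, !ip_rs_l, vi_vi_ip, ip_vi_l, o1, o2, o3, o4. split; ring.
    + replace (vsub (vsub (vsub x' (rs c f)) (rs d (vi f))) x)
        with (vsub (vsub (vsub x' x) (rs c f)) (rs d (vi f))) by vec.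
      apply Rle_trans with (1 := norm_sub _ _). rewrite norm_rs, norm_vi, pf.
      assert (e := norm_sub (vsub x' x) (rs c f)). rewrite norm_rs, pf in e. lra.
    + intro hx. destruct (r hx) as [k' ->].
      exists (vsub (vsub k' (rs c k)) (rs d (vi k))).
      rewrite !lin_sub, !Br, Bv, <- hk by exact B_lin. reflexivity.
Qed.

Lemma orthonormal_next l eps : 0 < eps -> orthonormal_in_range l ->
  exists e, nsq e = 1 /\ (exists k, e = B k) /\ (forall g, List.In g l -> ortho e g) /\
    norm (B e) <= eps.
Proof.
  assert (lB := B_lin). destruct lB as [Ba [Br Bv]].
  intros he hl. destruct (almost_ortho l hl) as [K [hK h]].
  (* The first bound keeps [norm x' >= norm x / 2] after orthogonalisation; the second gives
     [norm (B x') <= eps / 2 * norm x], so normalising leaves at most [eps]. *)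
  set (d := Rmin (/ (2 * (K + 1))) (eps / (2 * (K + 1)))).
  assert (p0 : 0 < / (2 * (K + 1))) by (apply Rinv_0_lt_compat; lra).
  assert (hd : 0 < d) by (apply Rmin_glb_lt; [lra|apply Rmult_lt_0_compat; lra]).
  assert (d1 : d * (K + 1) <= / 2).
  { apply Rle_trans with (/ (2 * (K + 1)) * (K + 1)); [|right; field; lra].
    apply Rmult_le_compat_r; [lra|apply Rmin_l]. }
  assert (d2 : d * (K + 1) <= eps / 2).
  { apply Rle_trans with (eps / (2 * (K + 1)) * (K + 1)); [|right; field; lra].
    apply Rmult_le_compat_r; [lra|apply Rmin_r]. }
  destruct (B_small d hd) as [x0 hx]. set (x := B x0) in *.
  destruct (h x) as [x' [o [b r]]].
  assert (px := norm_ge0 x).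
  assert (px0 : 0 < norm x). { assert (e := norm_ge0 (B x)). nra. }
  assert (b1 : norm (vsub x' x) <= K * d * norm x) by nra.
  assert (b2 : norm (B x') <= (K + 1) * d * norm x).
  { replace (B x') with (vadd (B x) (B (vsub x' x))) by (rewrite <- Ba; f_equal; vec).
    apply Rle_trans with (1 := norm_add _ _). assert (e := B_bound (vsub x' x)). lra. }
  assert (b3 : norm x / 2 <= norm x').
  { assert (t := norm_add x' (vopp (vsub x' x))). rewrite norm_opp in t.
    replace (vadd x' (vopp (vsub x' x))) with x in t by vec.
    assert (K * d * norm x <= / 2 * norm x) by (apply Rmult_le_compat_r; lra). lra. }
  assert (p : 0 < / norm x') by (apply Rinv_0_lt_compat; lra).
  exists (rs (/ norm x') x'). split; [|split; [|split]].
  - rewrite nsq_rs, <- norm_sq. field. lra.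
  - destruct r as [k ->]; [exists x0; reflexivity|]. exists (rs (/ norm (B k)) k). symmetry. apply Br.
  - intros g hg. destruct (o g hg) as [o1 o2]. split; rewrite ip_rs_l, ?o1, ?o2; ring.
  - rewrite Br, norm_rs, Rabs_pos_eq by lra.
    apply Rmult_le_reg_l with (norm x'); [lra|].
    replace (norm x' * (/ norm x' * norm (B x'))) with (norm (B x')) by (field; lra).
    assert ((K + 1) * d * norm x <= eps / 2 * norm x) by (apply Rmult_le_compat_r; lra).
    nra.
Qed.

Lemma orthonormal_sequence : exists e : nat -> H,
  (forall n, nsq (e n) = 1) /\ (forall n m, n <> m -> ortho (e n) (e m)) /\
  (forall n, norm (B (e n)) <= (/ 8) ^ n).
Proof.
  destruct (fun_choice (list H) H (fun l e => orthonormal_in_range l ->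
    nsq e = 1 /\ (exists k, e = B k) /\ (forall g, List.In g l -> ortho e g) /\
    norm (B e) <= (/ 8) ^ length l)) as [next hnext].
  { intro l. destruct (classic (orthonormal_in_range l)) as [hl|hl].
    - destruct (orthonormal_next l ((/ 8) ^ length l)) as [e he]; [apply pow_lt; lra|exact hl|].
      exists e. auto.
    - exists vzero. contradiction. }
  set (build := fix build n := match n with O => nil | S m => cons (next (build m)) (build m) end).
  assert (len : forall n, length (build n) = n).
  { induction n as [|n IH]; simpl; [reflexivity|]. f_equal. exact IH. }
  assert (ok : forall n, orthonormal_in_range (build n)).
  { induction n as [|n IH]; simpl; [exact I|]. destruct (hnext _ IH) as [h1 [h2 [h3 _]]]. auto. }
  assert (mem : forall n m, (n < m)%nat -> List.In (next (build n)) (build m)).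
  { intros n m hnm. induction m as [|m IH]; [lia|]. simpl.
    destruct (Nat.eq_dec n m) as [->|ne]; [left; reflexivity|right]. apply IH. lia. }
  exists (fun n => next (build n)). split; [|split].
  - intro n. apply hnext, ok.
  - intros n m ne. destruct (Nat.lt_gt_cases n m) as [h _]. destruct (h ne) as [l|l].
    + apply ortho_sym, hnext; [apply ok|apply mem, l].
    + apply hnext; [apply ok|apply mem, l].
  - intro n. rewrite <- (len n) at 2. apply hnext, ok.
Qed.

Lemma disjoint_operator : separable H -> exists P, lin P /\ (forall x, norm (P x) <= norm x) /\
  (forall x, P x = vzero -> x = vzero) /\
  (forall y k b, (forall h, ip k h = ip y (P h)) -> k = B b -> k = vzero).
Proof.
  intros [d hd]. assert (lB := B_lin). destruct lB as [Ba [Br Bv]].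
  destruct orthonormal_sequence as [e [e1 [e2 e3]]].
  assert (ne : forall n, norm (e n) <= 1).
  { intro n. apply norm_le; [lra|]. rewrite e1. lra. }
  assert (pd : forall k, 0 < / (1 + norm (d k))).
  { intro k. apply Rinv_0_lt_compat. assert (p := norm_ge0 (d k)). lra. }
  (* [rank1_bound] wants norm at most 1; the added 1 keeps the divisor positive when [d k]
     vanishes. *)
  set (d' := fun k => rs (/ (1 + norm (d k))) (d k)).
  assert (nd : forall k, norm (d' k) <= 1).
  { intro k. unfold d'. assert (p := pd k). assert (p' := norm_ge0 (d k)).
    rewrite norm_rs, Rabs_pos_eq by lra.
    apply Rmult_le_reg_l with (1 + norm (d k)); [lra|].
    rewrite <- Rmult_assoc, Rinv_r by lra. lra. }
  set (FG := fun j => rank1 ((/ 2) ^ j) (d' (recur j)) (e j)).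
  set (FU := fun j => rank1 ((/ 4) ^ j) (e j) (e (recur j))).
  destruct (series_exists FG (/ 2)) as [G [lG tG]]; [lra|intro; apply rank1_lin| |].
  { intros j x. apply rank1_bound; auto. apply pow_le. lra. }
  destruct (series_exists FU (/ 4)) as [U [lU tU]]; [lra|intro; apply rank1_lin| |].
  { intros j x. apply rank1_bound; auto. apply pow_le. lra. }
  assert (bG := fun x => series_bound FG (/ 2) G x tG).
  assert (bU := fun x => series_bound FU (/ 4) U x tU).
  exists (fun x => rs (/ 4) (vadd (G (B x)) (U x))).
  assert (eo : forall n m, n <> m -> ip (e n) (e m) = 0) by (intros; apply e2; auto).
  assert (eov : forall n m, ip (vi (e n)) (e m) = 0).
  { intros n m. rewrite ip_vi_l. destruct (Nat.eq_dec n m) as [->|hnm].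
    - rewrite ip_vi_self. ring.
    - rewrite (proj2 (e2 n m hnm)). ring. }
  split; [|split; [|split]].
  - destruct lG as [ga [gr gv]]. destruct lU as [ua [ur uv]]. repeat split; intros.
    + rewrite Ba, ga, ua. vec.
    + rewrite Br, gr, ur. vec.
    + rewrite Bv, gv, uv. vec.
  - intro x. rewrite norm_rs, Rabs_pos_eq by lra.
    assert (t := norm_add (G (B x)) (U x)). assert (t1 := bG (B x)). assert (t2 := bU x).
    assert (t3 := B_bound x). lra.
  - intros x hx. apply B_inj.
    assert (z : vadd (G (B x)) (U x) = vzero).
    { transitivity (rs 4 (rs (/ 4) (vadd (G (B x)) (U x)))); [vec|]. rewrite hx. vec. }
    assert (cG : forall n, ip (G (B x)) (e n) = (/ 2) ^ n * ip (B x) (d' (recur n))).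
    { intro n. rewrite (series_coord FG (/ 2) G (B x) (e n) n); [|lra|exact tG|].
      - unfold FG, rank1. rewrite ip_rs_l, ip_add_l, !ip_rs_l, eov. fold (nsq (e n)).
        rewrite e1. ring.
      - intros j hj. unfold FG, rank1. rewrite ip_rs_l, ip_add_l, !ip_rs_l, eov, eo by auto. ring. }
    (* For [j < n] also [recur j < n], so the first [n] terms of [U x] are orthogonal to [e n] and
       only the tail counts. *)
    assert (cU : forall n, Rabs (ip (U x) (e n)) <= 2 * (/ 4) ^ n * norm x).
    { intro n. replace (ip (U x) (e n)) with (ip (vsub (U x) (psum FU x n)) (e n)).
      - apply Rle_trans with (1 := cauchy_schwarz _ _). assert (t := tU n x).
        assert (t1 := ne n). assert (t2 := norm_ge0 (vsub (U x) (psum FU x n))). nra.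
      - rewrite ip_sub_l, psum_ip_0; [ring|]. intros j hj. unfold FU, rank1.
        assert (rj := recur_le j).
        rewrite ip_rs_l, ip_add_l, !ip_rs_l, eov, eo by lia. ring. }
    (* Pairing [G (B x) + U x = 0] with [e n] sets [2^-n] against [4^-n]; let [n] grow along
       [recur n = k]. *)
    assert (z0 : forall k, ip (B x) (d k) = 0).
    { intro k. assert (s : Rabs (ip (B x) (d' k)) <= 0).
      { apply le_pow_0 with (c := 2 * norm x) (q := / 2); [lra|]. intro n0.
        destruct (recur_io k n0) as [n [hn <-]]. exists n. split; [exact hn|].
        assert (c1 := cU n). assert (c2 := cG n).
        assert (c3 : ip (vadd (G (B x)) (U x)) (e n) = 0) by (rewrite z; apply ip_0_l).
        rewrite ip_add_l in c3.
        replace (ip (U x) (e n)) with (- ((/ 2) ^ n * ip (B x) (d' (recur n)))) in c1 by lra.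
        rewrite Rabs_Ropp, Rabs_mult, Rabs_pos_eq in c1 by (apply pow_le; lra).
        replace (/ 4) with (/ 2 * / 2) in c1 by lra. rewrite Rpow_mult_distr in c1.
        apply Rmult_le_reg_l with ((/ 2) ^ n); [apply pow_lt; lra|]. lra. }
      unfold d' in s. rewrite ip_rs_r, Rabs_mult, Rabs_pos_eq in s by (left; apply pd).
      assert (p := pd k). assert (p' := Rabs_pos (ip (B x) (d k))).
      destruct (Req_dec (ip (B x) (d k)) 0) as [q|q]; [exact q|].
      apply Rabs_pos_lt in q. nra. }
    apply norm_eq0, le_epsilon. intros eps he. destruct (hd (B x) eps he) as [k hk].
    assert (t := ip_le (B x) (vsub (B x) (d k))). rewrite ip_sub_r, z0 in t.
    fold (nsq (B x)) in t. rewrite <- norm_sq in t. assert (p := norm_ge0 (B x)).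
    destruct (Rle_lt_dec (norm (B x)) (0 + eps)) as [l|l]; [exact l|exfalso]. nra.
  (* Pairing [k] with [e j] gives [4^-j (y, e (recur j)) = 4 (b, B e_j) - (y, G (B e_j))], which is
     of order [8^-j]; let [j] grow along [recur j = n]. *)
  - assert (key : forall y k b, (forall h, ip k h = ip y (rs (/ 4) (vadd (G (B h)) (U h)))) ->
      k = B b -> forall n, ip y (e n) = 0).
    { intros y k b hk hb n. assert (s : Rabs (ip y (e n)) <= 0).
      { apply le_pow_0 with (c := 4 * norm b + 2 * norm y) (q := / 2); [lra|]. intro n0.
        destruct (recur_io n n0) as [j [hj <-]]. exists j. split; [exact hj|].
        assert (c := hk (e j)).
        assert (uj : U (e j) = rs ((/ 4) ^ j) (e (recur j))).
        { apply ip_ext. intro w. rewrite (series_coord FU (/ 4) U (e j) w j); [|lra|exact tU|].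
          - unfold FU, rank1. rewrite ip_vi_self. fold (nsq (e j)). rewrite e1. vexp. ring.
          - intros i hi. unfold FU, rank1. destruct (e2 j i ltac:(auto)) as [o1 o2].
            rewrite o1, o2. vexp. ring. }
        rewrite uj, hb, B_sym, ip_rs_r, ip_add_r, ip_rs_r in c.
        assert (c1 := cauchy_schwarz b (B (e j))). assert (c2 := cauchy_schwarz y (G (B (e j)))).
        assert (c3 := bG (B (e j))). assert (c4 := e3 j).
        assert (pb := norm_ge0 b). assert (py := norm_ge0 y).
        assert (c5 : Rabs (ip b (B (e j))) <= norm b * (/ 8) ^ j).
        { apply Rle_trans with (1 := c1). apply Rmult_le_compat_l; assumption. }
        assert (c6 : Rabs (ip y (G (B (e j)))) <= norm y * (2 * (/ 8) ^ j)).
        { apply Rle_trans with (1 := c2). apply Rmult_le_compat_l; [assumption|]. lra. }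
        assert (c7 : Rabs ((/ 4) ^ j * ip y (e (recur j))) <=
          (4 * norm b + 2 * norm y) * (/ 8) ^ j).
        { replace ((/ 4) ^ j * ip y (e (recur j))) with
            (4 * ip b (B (e j)) - ip y (G (B (e j)))) by lra.
          apply Rle_trans with (1 := Rabs_triang _ _).
          rewrite Rabs_Ropp, Rabs_mult, (Rabs_pos_eq 4) by lra. lra. }
        rewrite Rabs_mult, Rabs_pos_eq in c7 by (apply pow_le; lra).
        replace (/ 8) with (/ 4 * / 2) in c7 by lra. rewrite Rpow_mult_distr in c7.
        apply Rmult_le_reg_l with ((/ 4) ^ j); [apply pow_lt; lra|]. lra. }
      destruct (Req_dec (ip y (e n)) 0) as [q|q]; [exact q|]. apply Rabs_pos_lt in q. lra. }
    intros y k b hk hb. assert (k1 := key y k b hk hb).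
    (* The hypotheses are complex-linear, so [key] also applies to [vi y], [vi k] and [vi b]. *)
    assert (k2 : forall n, ip y (vi (e n)) = 0).
    { intro n. assert (c := ip_vi_l y (e n)). rewrite (key (vi y) (vi k) (vi b)) in c; [lra| |].
      - intro h. assert (t := hk (vi h)). rewrite !ip_vi_l, t. f_equal. f_equal.
        rewrite Bv, (proj2 (proj2 lG)), (proj2 (proj2 lU)). vec.
      - rewrite hb, Bv. reflexivity. }
    (* [nsq k = (y, P k)], and every term of the series for [P k] is orthogonal to [y]; the index 0
       picked below is arbitrary. *)
    apply nsq_eq0. unfold nsq. rewrite hk, ip_sym, ip_rs_l, ip_add_l.
    rewrite (series_coord FG (/ 2) G (B k) y 0), (series_coord FU (/ 4) U k y 0);
      try assumption; try lra.
    + unfold FG, FU, rank1. vexp. rewrite !(ip_sym _ y), !k1, !k2. ring.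
    + intros j _. unfold FU, rank1. vexp. rewrite !(ip_sym _ y), !k1, !k2. ring.
    + intros j _. unfold FG, rank1. vexp. rewrite !(ip_sym _ y), !k1, !k2. ring.
Qed.

End Disjoint.

(** * The complementary operator *)

(** Otherwise [norm (B x) >= d * norm x] on [dom S], the range of [B], and by density everywhere.
    Then [1 + S] is bounded by [1 / d], hence so is [S], and [T = S^2] is bounded by [1 / d^2]. *)
Lemma unbounded_resolvent_small S T B : psqrt S T -> resolvent_at_1 S B -> unbounded T ->
  forall d, 0 < d -> exists x, norm (B (B x)) < d * norm (B x).
Proof.
  intros hS hB hu d hd. apply NNPP. intro no. apply hu.
  assert (hS' := hS). destruct hS' as [hT [pS [hdom happ]]].
  assert (lB := resolvent_at_1_lin S B pS hB).
  assert (bB := fun x => resolvent_at_1_contract S B x pS hB).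
  assert (low : forall x, dom S x -> d * norm x <= norm (B x)).
  { intros x hx. rewrite <- (resolvent_at_1_inv S B x pS hB hx).
    destruct (Rle_lt_dec (d * norm (B (vadd x (app S x)))) (norm (B (B (vadd x (app S x))))))
      as [l|l]; [exact l|]. exfalso. apply no. eauto. }
  assert (low' : forall x, d * norm x <= norm (B x)).
  { intro x. assert (hpS := pS). destruct hpS as [_ [_ [_ [_ [_ [dd _]]]]]].
    destruct (dd x) as [u [hu1 hu2]]. apply le_epsilon. intros eps he.
    destruct (hu2 (eps / (d + 1))) as [N hN]; [apply Rdiv_lt_0_compat; lra|].
    assert (e := hN N (le_n _)). rewrite norm_sub_sym in e. assert (e1 := low (u N) (hu1 N)).
    assert (e2 := norm_add (u N) (vsub x (u N))).
    replace (vadd (u N) (vsub x (u N))) with x in e2 by vec.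
    assert (e3 := norm_sub (B x) (B (vsub x (u N)))).
    rewrite <- lin_sub in e3 by exact lB. replace (vsub x (vsub x (u N))) with (u N) in e3 by vec.
    assert (e4 := bB (vsub x (u N))).
    assert (e5 : (d + 1) * norm (vsub x (u N)) <= eps).
    { apply Rle_trans with ((d + 1) * (eps / (d + 1))); [|right; field; lra].
      apply Rmult_le_compat_l; lra. }
    nra. }
  assert (bS : forall x, dom S x -> d * norm (app S x) <= norm x).
  { intros x hx. assert (e := low' (vadd x (app S x))).
    rewrite resolvent_at_1_inv in e by auto.
    assert (e1 := psa_resolvent_bound S pS 1 x ltac:(lra) hx). rewrite rs_1 in e1.
    assert (e2 : norm (app S x) <= norm (vadd x (app S x))).
    { apply norm_le_nsq. assert (e3 := nsq_ge0 x). lra. }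
    apply Rle_trans with (2 := e). apply Rmult_le_compat_l; lra. }
  exists (/ (d * d)). intros x hx. assert (hx' := hx). apply hdom in hx'. destruct hx' as [d1 d2].
  assert (e1 := bS x d1). assert (e2 := bS _ d2). rewrite happ in e2 by exact hx.
  apply Rmult_le_reg_l with (d * d); [nra|].
  rewrite <- Rmult_assoc, Rinv_r by nra. nra.
Qed.

Section Construction.
Variables (T1 S1 : operator H) (A B P P' : H -> H).
Hypotheses (hS1 : psqrt S1 T1) (hA : resolvent_at_1 T1 A) (hB : resolvent_at_1 S1 B).
Hypothesis hk : trivial_kernel T1.
Hypotheses (lP : lin P) (bP : forall x, norm (P x) <= norm x).
Hypothesis iP : forall x, P x = vzero -> x = vzero.
Hypothesis disjP : forall y k b, (forall h, ip k h = ip y (P h)) -> k = B b -> k = vzero.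
Hypotheses (lP' : lin P') (bP' : forall x, norm (P' x) <= norm x).
Hypothesis adjP : forall x y, ip (P' x) y = ip x (P y).

Let pS1 : psa S1 := proj1 (proj2 hS1).
Let lB : lin B := resolvent_at_1_lin S1 B pS1 hB.

(* [compl] is [Q^* Q] with [Q = P (1 - B)] and [B = (1 + S1)^-1]; the form domain
   of [compl^-1 - 1] is the range of [Q^* = (1 - B) P^*]. *)
Definition compl_root x : H := P (vsub x (B x)).
Definition compl_adj y : H := vsub (P' y) (B (P' y)).
Definition compl x : H := compl_adj (compl_root x).

Lemma compl_root_lin : lin compl_root.
Proof.
  destruct lP as [a [r v]]. destruct lB as [a' [r' v']].
  unfold compl_root. repeat split; intros.
  - rewrite <- a, a'. f_equal. vec.
  - rewrite <- r, r'. f_equal. vec.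
  - rewrite <- v, v'. f_equal. vec.
Qed.

Lemma compl_adj_ip x y : ip (compl_adj x) y = ip x (compl_root y).
Proof.
  unfold compl_adj, compl_root. rewrite <- adjP, ip_sub_l, ip_sub_r.
  rewrite (resolvent_at_1_sym S1 B) by assumption. reflexivity.
Qed.

Lemma compl_lin : lin compl.
Proof.
  destruct lP' as [a [r v]]. destruct lB as [a' [r' v']]. destruct compl_root_lin as [a2 [r2 v2]].
  unfold compl, compl_adj. repeat split; intros.
  - rewrite a2, a, a'. vec.
  - rewrite r2, r, r'. vec.
  - rewrite v2, v, v'. vec.
Qed.

Lemma compl_form x y : ip (compl x) y = ip (compl_root x) (compl_root y).
Proof. apply compl_adj_ip. Qed.

Lemma compl_sym x y : ip (compl x) y = ip x (compl y).
Proof. rewrite (ip_sym x), !compl_form. apply ip_sym. Qed.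

(** [1 - B] vanishes exactly on the kernel of [S1], which lies in that of [T1]; here
    [trivial_kernel T1] enters. *)
Lemma compl_inj x : compl x = vzero -> x = vzero.
Proof.
  intro e. assert (e1 : compl_root x = vzero).
  { apply nsq_eq0. unfold nsq. rewrite <- compl_form, e. apply ip_0_l. }
  apply iP, vsub_eq0 in e1. destruct (hB x) as [d ex]. rewrite <- e1 in d, ex.
  assert (z : app S1 x = vzero).
  { transitivity (vsub (vadd x (app S1 x)) x); [vec|]. rewrite ex. vec. }
  assert (hS1' := hS1). destruct hS1' as [_ [_ [hd he]]].
  assert (dT : dom T1 x).
  { apply hd. split; [exact d|]. rewrite z. apply (psa_dom_0 S1 pS1). }
  apply hk; [exact dT|]. rewrite <- he, z by exact dT. apply (psa_app_0 S1 pS1).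
Qed.

(** With [k = P' y], the cross term is [2 (S1 f, B k)], at most [nsq (S1 f) + nsq (B k)], while
    [B^2 <= B] gives [nsq (k - B k) + nsq (B k) <= nsq k]. Taking [f = A x] and [y = compl_root x]
    yields [A + C <= 1]. *)
Lemma nsq_compl_adj_add f y : dom S1 f ->
  nsq (vadd f (compl_adj y)) <= gsq S1 f + nsq y.
Proof.
  intro hf. unfold compl_adj. set (k := P' y).
  assert (e1 : nsq k <= nsq y). { rewrite <- (norm_sq y). apply nsq_le, bP'. }
  assert (e2 := resolvent_at_1_ge S1 B k pS1 hB).
  (* with [f = B a]: [(f, k - B k) = (S1 f, B k)] *)
  assert (e3 : ip f (vsub k (B k)) = ip (app S1 f) (B k)).
  { assert (e := resolvent_at_1_inv S1 B f pS1 hB hf).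
    assert (s := resolvent_at_1_sym S1 B (vadd f (app S1 f)) k pS1 hB).
    rewrite e, ip_add_l in s. rewrite ip_sub_r. lra. }
  assert (e4 := nsq_ge0 (vsub (app S1 f) (B k))). rewrite nsq_sub in e4.
  rewrite nsq_add, e3, (nsq_sub k), (ip_sym k). unfold gsq. lra.
Qed.

Lemma compl_ge x : nsq (compl x) <= ip (compl x) x.
Proof.
  assert (e := nsq_compl_adj_add vzero (compl_root x) (psa_dom_0 S1 pS1)).
  unfold gsq in e. rewrite (psa_app_0 S1 pS1) in e.
  replace (vadd vzero (compl_adj (compl_root x))) with (compl x) in e by (unfold compl; vec).
  unfold nsq at 2 3 in e. rewrite ip_0_l in e. rewrite compl_form. unfold nsq in *. lra.
Qed.

Lemma compl_add_ge x : nsq (vadd (A x) (compl x)) <= ip (vadd (A x) (compl x)) x.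
Proof.
  rewrite ip_add_l, compl_form. rewrite <- (psqrt_gsq_resolvent S1 T1 A x hS1 hA).
  apply nsq_compl_adj_add. apply psqrt_resolvent_dom with T1; assumption.
Qed.

Lemma compl_add_inj x : vadd (A x) (compl x) = vzero -> x = vzero.
Proof.
  intro e. apply compl_inj, nsq_eq0.
  assert (e1 : ip (A x) x + ip (compl x) x = 0) by (rewrite <- ip_add_l, e; apply ip_0_l).
  assert (e2 := compl_ge x). assert (e3 := resolvent_at_1_ge T1 A x (proj1 hS1) hA).
  assert (e4 := nsq_ge0 (A x)). assert (e5 := nsq_ge0 (compl x)). lra.
Qed.

(** [gsq S2 (compl h) = nsq (compl_root h)], so graph convergence of [u n = compl (h n)] makes
    [compl_root (h n)] converge, and [compl_adj] maps its limit to [x]. *)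
Lemma compl_range S2 T2 x : psqrt S2 T2 -> resolvent_at_1 T2 compl -> dom S2 x ->
  exists y, x = compl_adj y.
Proof.
  intros hS2 hC hx. destruct (psqrt_core S2 T2 x hS2 hx) as [u [du [cu cSu]]].
  assert (hS2' := hS2). destruct hS2' as [pT2 [pS2 _]].
  set (h := fun n => vadd (u n) (app T2 (u n))).
  assert (eC : forall n, compl (h n) = u n) by (intro n; apply resolvent_at_1_inv; auto).
  assert (dS2 : forall n, dom S2 (u n)).
  { intro n. rewrite <- eC. apply psqrt_resolvent_dom with T2; auto. }
  destruct (cauchy_cvg (fun n => compl_root (h n))) as [y hy].
  { apply cauchy_of_nsq_le with u (fun n => app S2 (u n)); [|eapply cvg_cauchy; eassumption..].
    intros n m. rewrite <- (lin_sub compl_root) by apply compl_root_lin.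
    unfold nsq at 1. rewrite <- compl_form, <- (psqrt_gsq_resolvent S2 T2 compl) by assumption.
    rewrite (lin_sub compl) by apply compl_lin. rewrite !eC.
    unfold gsq. rewrite (psa_app_sub S2 pS2) by apply dS2. lra. }
  exists y. apply ip_ext. intro w. rewrite compl_adj_ip.
  eapply Un_cv_eq; [|exact (cvg_ip _ _ _ _ cu (cvg_const w))|
    exact (cvg_ip _ _ _ _ hy (cvg_const (compl_root w)))].
  intro n. simpl. rewrite <- compl_form, eC. reflexivity.
Qed.

Lemma compl_disjoint y : dom S1 (compl_adj y) -> compl_adj y = vzero.
Proof.
  intro d. set (b := vadd (compl_adj y) (app S1 (compl_adj y))).
  assert (e : B b = compl_adj y) by (apply resolvent_at_1_inv; auto).
  assert (z : P' y = vzero).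
  { apply disjP with y (vadd b (P' y)); [apply adjP|].
    rewrite (proj1 lB), e. unfold compl_adj. vec. }
  unfold compl_adj. rewrite z, (lin_0 B lB). vec.
Qed.

End Construction.

(** * Choice of [T2] and [T], and derivation of the four claims *)

Lemma disjoint_form_domains T1 S1 : separable H -> psqrt S1 T1 -> unbounded T1 -> trivial_kernel T1 ->
  exists T2 T A C Z, psa T2 /\ psa T /\ resolvent_at_1 T1 A /\ resolvent_at_1 T2 C /\
    resolvent_at_1 T Z /\ (forall h, Z h = vadd (A h) (C h)) /\
    forall S1' S2 x, psqrt S1' T1 -> psqrt S2 T2 -> dom S1' x -> dom S2 x -> x = vzero.
Proof.
  intros hsep hS1 hu hk. assert (hS1' := hS1). destruct hS1' as [pT1 [pS1 _]].
  destruct (resolvent_at_1_exists T1 pT1) as [A hA].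
  destruct (resolvent_at_1_exists S1 pS1) as [B hB].
  assert (lA := resolvent_at_1_lin T1 A pT1 hA).
  destruct (disjoint_operator B) as [P [lP [bP [iP disjP]]]]; try assumption.
  { apply resolvent_at_1_lin with S1; assumption. }
  { intros. apply resolvent_at_1_sym with S1; assumption. }
  { intro. apply resolvent_at_1_contract with S1; assumption. }
  { intro. apply resolvent_at_1_inj with S1; assumption. }
  { apply unbounded_resolvent_small with S1 T1; assumption. }
  destruct (adjoint_exists P lP bP) as [P' [lP' [bP' adjP]]].
  set (C := compl B P P').
  assert (lC : lin C) by (apply (compl_lin T1 S1); assumption).
  destruct (inverse_sub_1 C) as [T2 [pT2 hC]]; [exact lC|..].
  { apply (compl_sym T1 S1); assumption. }
  { apply (compl_inj T1 S1); assumption. }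
  { apply (compl_ge T1 S1); assumption. }
  destruct (inverse_sub_1 (fun h => vadd (A h) (C h))) as [T [pT hZ]].
  { destruct lA as [a [r v]]. destruct lC as [a' [r' v']]. repeat split; intros.
    - rewrite a, a'. vec.
    - rewrite r, r'. vec.
    - rewrite v, v'. vec. }
  { intros x y. rewrite ip_add_l, ip_add_r, (resolvent_at_1_sym T1 A) by assumption.
    f_equal. apply (compl_sym T1 S1); assumption. }
  { apply (compl_add_inj T1 S1); assumption. }
  { apply (compl_add_ge T1 S1); assumption. }
  exists T2, T, A, C, (fun h => vadd (A h) (C h)). repeat (split; [assumption|]).
  split; [reflexivity|].
  intros S1' S2 x hS1' hS2 d1 d2.
  (* Comparing [A] with itself shows that any square root of [T1] has its domain inside that of
     [S1], so uniqueness of square roots is not invoked. *)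
  destruct (psqrt_dom_incl S1 T1 A S1' T1 A x hS1 hA hS1' hA (fun h => Rle_refl _) d1) as [d _].
  destruct (compl_range T1 S1 B P P' hS1 hB lP lP' adjP S2 T2 x hS2 hC d2) as [y ->].
  apply (compl_disjoint T1 S1 B P P'); assumption.
Qed.

End Hilbert.

Theorem theorem3p25 (H : PreHilbert)
  (Hcomplete : complete H) (Hsep : separable H) (Hinf : infinite_dimensional H)
  (T1 : operator H)
  (hT1 : nonneg_self_adjoint T1) (hT1u : unbounded T1) (hT1k : trivial_kernel T1) :
  exists T2 T : operator H,
    nonneg_self_adjoint T2 /\ nonneg_self_adjoint T /\
    forall S1 S2 S : operator H,
      is_sqrt S1 T1 -> is_sqrt S2 T2 -> is_sqrt S T ->
      (* (1) *)
      (forall x, dom S1 x -> dom T x -> x = vzero) /\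
      (forall x, dom S2 x -> dom T x -> x = vzero) /\
      (* (2) *)
      (forall g, dom S1 g -> dom S g /\ norm (app S1 g) = norm (app S g)) /\
      (forall g, dom S2 g -> dom S g /\ norm (app S2 g) = norm (app S g)) /\
      (* (3) *)
      (forall x, dom S1 x -> dom S2 x -> x = vzero) /\
      (* (4) direct sum, orthogonal w.r.t. (f,g)_{T^{1/2}} *)
      (forall x, dom S x <->
         exists a b, dom S1 a /\ dom S2 b /\ x = vadd a b) /\
      (forall a b, dom S1 a -> dom S2 b ->
         Cadd (inner (app S a) (app S b)) (inner a b) = C0).
Proof.
  destruct (classic (exists S1, is_sqrt S1 T1)) as [[S0 hS0]|no].
  - destruct (disjoint_form_domains H Hcomplete T1 S0) as [T2 [T [A [C [Z [pT2 [pT [hA [hC [hZ [sum disj]]]]]]]]]]];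
      try assumption.
    { apply psqrt_of_is_sqrt; assumption. }
    apply psa_iff in pT2, pT. exists T2, T. split; [exact pT2|]. split; [exact pT|].
    intros S1 S2 S h1 h2 h.
    apply psqrt_of_is_sqrt in h1, h2, h; try assumption.
    assert (d : forall x, dom S1 x -> dom S2 x -> x = vzero).
    { intros x. apply (disj S1 S2); assumption. }
    assert (qT := proj1 h).
    assert (il := sum_dom_incl_l H Hcomplete S S1 S2 T T1 T2 Z A C h h1 h2 hZ hA hC sum).
    assert (ir := sum_dom_incl_r H Hcomplete S S1 S2 T T1 T2 Z A C h h1 h2 hZ hA hC sum).
    assert (gl := sum_gsq_l H Hcomplete S S1 S2 T T1 T2 Z A C h h1 h2 hZ hA hC sum d).
    assert (gr := sum_gsq_r H Hcomplete S S1 S2 T T1 T2 Z A C h h1 h2 hZ hA hC sum d).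
    assert (one : forall x, dom T x -> dom S1 x \/ dom S2 x -> x = vzero).
    { intros x hx hd. rewrite <- (resolvent_at_1_inv H T Z x qT hZ hx) in hd |- *.
      rewrite (sum_resolvent_ortho H S1 S2 T1 T2 Z A C h1 h2 hA hC sum d _ hd).
      apply lin_0. apply (resolvent_at_1_lin H T Z); assumption. }
    (* Equal graph norms at [x] share the summand [nsq x]. *)
    assert (eqn : forall S' S'' : operator H, forall x, gsq H S' x = gsq H S'' x ->
      norm (app S' x) = norm (app S'' x)).
    { intros S' S'' x e. unfold norm. f_equal. unfold gsq, nsq, ip in e. lra. }
    split; [intros x hx ht; apply one; auto|].
    split; [intros x hx ht; apply one; auto|].
    split; [intros g hg; split; [apply il, hg|apply eqn, gl, hg]|].
    split; [intros g hg; split; [apply ir, hg|apply eqn, gr, hg]|].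
    split; [exact d|]. split; [intro x; split|].
    + intro hx. destruct (sum_decompose H Hcomplete S S1 S2 T T1 T2 Z A C h h1 h2 hZ hA hC sum x hx)
        as [a [b [ha [hb [e _]]]]]. eauto.
    + intros [a [b [ha [hb ->]]]]. apply psa_dom_add; [apply h|apply il, ha|apply ir, hb].
    + intros a b ha hb. apply (sum_ortho H Hcomplete S S1 S2 T T1 T2 Z A C); assumption.
  - exists T1, T1. split; [exact hT1|]. split; [exact hT1|].
    intros S1 S2 S h1. exfalso. apply no. exists S1. exact h1.
Qed.
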